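(* Let $G$ be a finite directed graph. The regular magnitude-path spectral sequence $IE^{*,*}_*$, i.e. the spectral sequence associated to the filtration $F_*N^\iota(\mathrm{Reach}_G)$ of the injective nerve $N^\iota(\mathrm{Reach}_G)$, satisfies the following properties. (1) The first page is the eulerian magnitude homology of $G$: $IE^{\ell,1}_k\cong \mathrm{EMH}_{k,\ell}(G)$ for all $k,\ell$. (2) The diagonal of the second page is the regular path homology of $G$: for every $k\geq 0$, $IE^{k,2}_k$ is isomorphic to the $k$-th regular path homology group $H_k(\Omega^\iota_*(G),\partial)$. (3) It converges to the homology of the complex of injective words $\mathrm{Inj}(G)$ on $G$. (4) The inclusions $F_\ell N^\iota(\mathrm{Reach}_G)\subseteq F_\ell N(\mathrm{Reach}_G)$ induce a map of spectral sequences from $IE^{*,r}_*$ to the magnitude-path spectral sequence, i.e. the spectral sequence associated to the filtration $F_*N(\mathrm{Reach}_G)$ of the nerve $N(\mathrm{Reach}_G)$.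
   Context: $R$ is a fixed commutative unital ring; all homology has coefficients in $R$. A directed graph $G$ has vertex set $V(G)$ and edge set $E(G)\subseteq V(G)\times V(G)$; $d_G(x,y)$ is the minimal length of a directed path from $x$ to $y$ ($0$ if $x=y$, $\infty$ if there is none), and $\mathrm{len}(x_0,\dots,x_k)=\sum_{i=0}^{k-1}d_G(x_i,x_{i+1})$ when all terms are finite. Eulerian magnitude homology: $\mathrm{EMC}_{k,\ell}(G)$ is the free $R$-module on tuples $(x_0,\dots,x_k)$ of pairwise distinct vertices with $d_G(x_i,x_{i+1})<\infty$ for all $i$ and length $\ell$; $\partial=\sum_{i=1}^{k-1}(-1)^i\partial_i$, where $\partial_i$ deletes $x_i$ if the resulting tuple still has length $\ell$ and is $0$ otherwise; $\mathrm{EMH}_{k,\ell}(G)=H_k(\mathrm{EMC}_{*,\ell}(G),\partial)$. Regular path homology: let $\Lambda_n(G)$ be the free $R$-module on all $(n+1)$-tuples of vertices, with $\partial=\sum_{i=0}^n(-1)^i(\text{delete the } i\text{-th entry})$ (and $\partial=0$ for $n=0$). A tuple $(x_0,\dots,x_n)$ is allowed if $(x_i,x_{i+1})\in E(G)$ for all $i$, and strongly regular if its entries are pairwise distinct. Let $\mathcal{A}^\iota_n(G)\subseteq\Lambda_n(G)$ be spanned by the strongly regular allowed tuples, and $\Omega^\iota_n(G)=\{v\in\mathcal{A}^\iota_n(G)\mid \partial v\in\mathcal{A}^\iota_{n-1}(G)\}$ (with $\Omega^\iota_0=\mathcal{A}^\iota_0$). The homology groups of the chain complex $(\Omega^\iota_*(G),\partial)$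 are the regular path homology groups of $G$. Reachability category: $\mathrm{Reach}_G$ has the vertices of $G$ as objects, exactly one morphism $v\to w$ if there is a directed path in $G$ from $v$ to $w$ (including the trivial path, giving the identity), and none otherwise. $N(\mathrm{Reach}_G)$ is its nerve; its $k$-simplices are the tuples $(x_0,\dots,x_k)$ of vertices such that there is a directed path from $x_i$ to $x_{i+1}$ for each $i$. The injective nerve $N^\iota(\mathrm{Reach}_G)\subseteq N(\mathrm{Reach}_G)$ is the simplicial subset whose non-degenerate $p$-simplices are the tuples $(x_0,\dots,x_p)$ of pairwise distinct vertices such that there is a directed path from $x_i$ to $x_{i+1}$ for all $i$ (its other simplices are degeneracies of these). Filtrations: $F_\ell N(\mathrm{Reach}_G)$ and $F_\ell N^\iota(\mathrm{Reach}_G)$ are the simplicial subsets consisting of the simplices $(x_0,\dots,x_k)$ with $\mathrm{len}(x_0,\dots,x_k)\leq \ell$. The associated spectral sequence is that of the induced filtration on the normalized chain complex (with coefficients in $R$). Indexing: $\ell$ is the filtration degree, $k$ the chain degree, $r$ the page, so $IE^{\ell,0}_k$ is the degree-$k$ part of the quotient of the $\ell$-th by the $(\ell-1)$-st filtration step of normalized chains of $N^\iota(\mathrm{Reach}_G)$, and the $r$-th differential goes $IE^{\ell,r}_k\to IE^{\ell-r,r}_{k-1}$. Complex of injective words: $\mathrm{Inj}(G)$ is the complex whose $p$-simplices are the words $x_0\cdots x_p$ of pairwise distinct vertices of $G$ such that for all $i<j$ there is a directed path in $G$ from $x_i$ to $x_j$, with faces given by deleting letters. *)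

(* Defs.v *)
From HB Require Import structures.
From mathcomp Require Import all_boot all_order all_algebra.
From mathcomp Require Import boolp zify.

Set Implicit Arguments.
Unset Strict Implicit.
Unset Printing Implicit Defensive.

Import Order.TTheory GRing.Theory Num.Theory.
Local Open Scope ring_scope.
Local Open Scope quotient_scope.

Section Submodules.
Variables (R : comPzRingType) (M : lmodType R).

Record submod := Submod {
  submod_pred :> {pred M};
  submod_closedP : submod_closed submod_pred }.

HB.instance Definition _ (S : submod) :=
  GRing.isSubmodClosed.Build R M (submod_pred S)
    (GRing.submod_closed_semi (submod_closedP S)).

Record submod_type (S : submod) := SubmodType {
  submod_val : M;
  submod_valP : submod_val \in S }.

Section Instances.
Variable S : submod.
HB.instance Definition _ := [isSub of submod_type S for @submod_val S].
HB.instance Definition _ := [Choice of submod_type S by <:].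
HB.instance Definition _ :=
  GRing.SubChoice_isSubLmodule.Build R M (submod_pred S) (submod_type S)
    (submod_closedP S).
End Instances.

Definition quomod (T : submod) : Type := Quotient.quot (submod_pred T).

Section Quotient.
Variable T : submod.
HB.instance Definition _ := GRing.Zmodule.on (quomod T).
HB.instance Definition _ := Quotient.on (quomod T).

Definition quomod_scale (a : R) (x : quomod T) : quomod T :=
  \pi_(quomod T) (a *: repr x).

Lemma quomod_eqP (x y : M) :
  reflect (\pi_(quomod T) x = \pi_(quomod T) y) (x - y \in T).
Proof. by rewrite Quotient.idealrBE; apply: eqP. Qed.

Lemma quomod_scaleE a (x : M) :
  quomod_scale a (\pi x) = \pi_(quomod T) (a *: x).
Proof.
apply/quomod_eqP; rewrite -scalerBr; apply: rpredZ.
exact: introT (quomod_eqP _ _) (reprK _).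
Qed.

Lemma quomod_scaleA a b x :
  quomod_scale a (quomod_scale b x) = quomod_scale (a * b) x.
Proof. by rewrite -[x]reprK (quomod_scaleE b) !quomod_scaleE scalerA. Qed.

Lemma quomod_scale1 : left_id 1 quomod_scale.
Proof. by move=> x; rewrite -[x]reprK quomod_scaleE scale1r. Qed.

Lemma quomod_scaleDr : right_distributive quomod_scale +%R.
Proof.
by move=> a x y; rewrite -[x]reprK -[y]reprK -raddfD !quomod_scaleE scalerDr raddfD.
Qed.

Lemma quomod_scaleDl x : {morph quomod_scale^~ x : a b / a + b}.
Proof. by move=> a b; rewrite -[x]reprK !quomod_scaleE scalerDl raddfD. Qed.

HB.instance Definition _ := GRing.Zmodule_isLmodule.Build R (quomod T)
  quomod_scaleA quomod_scale1 quomod_scaleDr quomod_scaleDl.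

Definition quomod_class (x : M) : quomod T := \pi_(quomod T) x.

Lemma quomod_class_linear : linear quomod_class.
Proof.
move=> a x y; rewrite /quomod_class raddfD; congr (_ + _).
exact: esym (quomod_scaleE a x).
Qed.

HB.instance Definition _ := GRing.isLinear.Build R M (quomod T) _ quomod_class
  quomod_class_linear.

Lemma quomod_classP (x : quomod T) : exists y, x = quomod_class y.
Proof. by exists (repr x); rewrite /quomod_class reprK. Qed.

Lemma quomod_class_eqP x y :
  reflect (quomod_class x = quomod_class y) (x - y \in T).
Proof. exact: quomod_eqP. Qed.
End Quotient.
End Submodules.

Section Subquotients.
Variable R : comPzRingType.
Implicit Types M : lmodType R.

Definition lmod_iso (M M' : lmodType R) : Prop :=
  exists f : {linear M -> M'}, bijective f.

Section SubQuo.
Variables (M : lmodType R) (S T : submod M).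

Definition trace_pred : {pred submod_type S} := [pred x | val x \in T].

Lemma trace_closed : submod_closed trace_pred.
Proof.
split=> [|a x y]; rewrite !inE ?raddf0 ?rpred0 // => Tx Ty.
by rewrite linearP rpredD ?rpredZ.
Qed.

Definition trace : submod (submod_type S) := Submod trace_closed.

(* S / (S :&: T), that is S / T whenever T is contained in S *)
Definition subquo : lmodType R := quomod trace.

Definition subquo_class : {linear submod_type S -> subquo} := @quomod_class R _ trace.

Lemma subquo_classP (x : subquo) : exists y, x = subquo_class y.
Proof. exact: quomod_classP. Qed.

Lemma subquo_class_eqP x y :
  reflect (subquo_class x = subquo_class y) (val x - val y \in T).
Proof. by rewrite -linearB; apply: quomod_class_eqP. Qed.

Lemma subquo_class0P x : reflect (subquo_class x = 0) (val x \in T).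
Proof.
apply: (iffP idP) => [Tx|x0].
  rewrite -(raddf0 subquo_class).
  by apply/subquo_class_eqP; rewrite raddf0 addr0.
have /subquo_class_eqP : subquo_class x = subquo_class 0 by rewrite x0 raddf0.
by rewrite raddf0 addr0.
Qed.

End SubQuo.

Lemma inj_surj_bij (A B : Type) (f : A -> B) :
  injective f -> (forall y, exists x, f x = y) -> bijective f.
Proof.
move=> f_inj f_surj; exists (fun y => sval (cid (f_surj y))) => [x|y].
  by apply: f_inj; case: (cid _).
by case: (cid _).
Qed.

Section SubQuoLift.
Variables (M N : lmodType R) (S T : submod M) (f : {linear submod_type S -> N}).
Hypothesis fT0 : forall x, val x \in T -> f x = 0.

Definition subquo_lift_fun (x : subquo S T) : N := f (repr (x : quomod (trace S T))).

Lemma subquo_lift_funE x : subquo_lift_fun (subquo_class S T x) = f x.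
Proof.
apply/eqP; rewrite -subr_eq0 -linearB; apply/eqP/fT0.
apply: (introT (@subquo_class_eqP _ _ _ _ _)).
exact: (reprK (subquo_class S T x : quomod (trace S T))).
Qed.

Lemma subquo_lift_linear : linear subquo_lift_fun.
Proof.
move=> a x y; have [u ->] := subquo_classP x; have [v ->] := subquo_classP y.
by rewrite -linearP !subquo_lift_funE linearP.
Qed.

HB.instance Definition _ := GRing.isLinear.Build R (subquo S T) N _
  subquo_lift_fun subquo_lift_linear.

Definition subquo_lift : {linear subquo S T -> N} := subquo_lift_fun.

Lemma subquo_liftE x : subquo_lift (subquo_class S T x) = f x.
Proof. exact: subquo_lift_funE. Qed.
End SubQuoLift.

Section SubQuoMap.
Variables (M M' : lmodType R) (S T : submod M) (S' T' : submod M').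
Variable f : {linear M -> M'}.
Hypothesis fS : forall x, x \in S -> f x \in S'.
Hypothesis fT : forall x, x \in S -> x \in T -> f x \in T'.

Definition submod_map (x : submod_type S) : submod_type S' :=
  SubmodType (fS (submod_valP x)).

Definition submod_map_class (x : submod_type S) : subquo S' T' :=
  subquo_class S' T' (submod_map x).

Lemma submod_map_linear : linear submod_map_class.
Proof.
move=> a x y; rewrite /submod_map_class -linearP; congr (subquo_class _ _ _).
by apply: val_inj; rewrite /= linearP.
Qed.

HB.instance Definition _ := GRing.isLinear.Build R (submod_type S) (subquo S' T')
  _ submod_map_class submod_map_linear.

Lemma submod_map0 (x : submod_type S) : val x \in T -> submod_map_class x = 0.
Proof.
by move=> Tx; apply/subquo_class0P; apply: fT => //; apply: submod_valP.
Qed.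

Definition subquo_map : {linear subquo S T -> subquo S' T'} :=
  subquo_lift submod_map0.

Lemma subquo_mapE x :
  subquo_map (subquo_class S T x) = subquo_class S' T' (submod_map x).
Proof. exact: subquo_liftE. Qed.
End SubQuoMap.

Section KerIm.
Variables (M N : lmodType R) (f : {linear M -> N}).

Lemma ker_closed : submod_closed [pred x | f x == 0].
Proof.
split=> [|a x y]; rewrite !inE ?raddf0 // => /eqP fx /eqP fy.
by rewrite linearP fx fy scaler0 addr0.
Qed.
Definition ker : submod M := Submod ker_closed.

Lemma im_closed : submod_closed [pred y | `[< exists x, f x = y >]].
Proof.
split=> [|a _ _ /asboolP[x <-] /asboolP[y <-]]; apply/asboolP.
  by exists 0; rewrite raddf0.
by exists (a *: x + y); rewrite linearP.
Qed.
Definition im : submod N := Submod im_closed.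

Lemma kerP x : reflect (f x = 0) (x \in ker). Proof. exact: eqP. Qed.
Lemma imP y : reflect (exists x, f x = y) (y \in im). Proof. exact: asboolP. Qed.
End KerIm.

(* ker g / im f for composable f and g with g \o f = 0 *)
Definition homology (A B C : lmodType R) (f : {linear A -> B})
  (g : {linear B -> C}) : lmodType R := subquo (ker g) (im f).

Section HomologyMap.
Variables (A B C A' B' C' : lmodType R).
Variables (f : {linear A -> B}) (g : {linear B -> C}).
Variables (f' : {linear A' -> B'}) (g' : {linear B' -> C'}).
Variables (a : {linear A -> A'}) (b : {linear B -> B'}) (c : {linear C -> C'}).
Hypothesis bf : forall x, b (f x) = f' (a x).
Hypothesis cg : forall x, c (g x) = g' (b x).

Lemma homology_map_ker x : x \in ker g -> b x \in ker g'.
Proof. by move=> /kerP gx; apply/kerP; rewrite -cg gx raddf0. Qed.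

Lemma homology_map_im x : x \in ker g -> x \in im f -> b x \in im f'.
Proof. by move=> _ /imP[y <-]; apply/imP; exists (a y); rewrite bf. Qed.

Definition homology_map : {linear homology f g -> homology f' g'} :=
  subquo_map homology_map_ker homology_map_im.
End HomologyMap.

(* Chain complexes in degrees k >= 0; the differential out of degree 0 is
   the zero map 'C_0 -> C_0'. *)
Record complex := Complex {
  chain_mod :> nat -> lmodType R;
  bnd : forall k, {linear chain_mod k -> chain_mod k.-1};
  bnd0 : forall x, bnd 0 x = 0;
  bndK : forall k x, bnd k.-1 (bnd k x) = 0 }.

Definition Hn (C : complex) (k : nat) : lmodType R :=
  @homology (C k.+1) (C k) (C k.-1) (bnd C k.+1) (bnd C k).

Lemma bndSK (C : complex) k (x : C k.+1) : bnd C k (bnd C k.+1 x) = 0.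
Proof. exact: (@bndK C k.+1 x). Qed.

(* page l r k: filtration degree l, page r, chain degree k. The equation on l'
   keeps the index of the target of diff flexible: l + r - r is not convertible
   to l. The map next identifies page r.+1 with the homology of page r. *)
Record spectral_seq := SpectralSeq {
  page : int -> nat -> nat -> lmodType R;
  diff : forall (l l' : int) (r k : nat), l' = l - r%:Z ->
    {linear page l r k -> page l' r k.-1};
  diff0 : forall l l' r (h : l' = l - r%:Z) (x : page l r 0), diff 0 h x = 0;
  diffK : forall l l' l'' r k (h : l' = l - r%:Z) (h' : l'' = l' - r%:Z)
    (x : page l r k), diff k.-1 h' (diff k h x) = 0;
  next : forall l r k, {linear page l r.+1 k ->
    @homology (page (l + r%:Z) r k.+1) (page l r k) (page (l - r%:Z) r k.-1)
      (diff k.+1 (esym (addrK r%:Z l))) (diff k (erefl (l - r%:Z)))};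
  next_bij : forall l r k, bijective (next l r k) }.

Record ss_hom (E E' : spectral_seq) := SSHom {
  ss_map :> forall l r k, {linear page E l r k -> page E' l r k};
  ss_map_diff : forall l l' r k (h : l' = l - r%:Z) (x : page E l r k),
    ss_map l' r k.-1 (diff E k h x) = diff E' k h (ss_map l r k x);
  ss_map_next : forall l r k (x : page E l r.+1 k),
    next E' l r k (ss_map l r.+1 k x) =
    homology_map (ss_map_diff (esym (addrK r%:Z l)))
      (ss_map_diff (erefl (l - r%:Z))) (next E l r k x) }.

(* Bounded convergence: each H k carries a finite filtration, whose l-th
   graded piece is the stable value of page l r k for large r. *)
Definition converges_to (E : spectral_seq) (H : nat -> lmodType R) : Prop :=
  exists Phi : int -> forall k, submod (H k),
  [/\ forall l l' k x, l <= l' -> x \in Phi l k -> x \in Phi l' k,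
      forall k, exists a b : int,
        (forall x, x \in Phi a k -> x = 0) /\ (forall x, x \in Phi b k)
    & forall l k, exists r0 : nat, forall r, (r0 <= r)%N ->
        [/\ forall x : page E l r k, diff E k (erefl (l - r%:Z)) x = 0,
            forall x : page E (l + r%:Z) r k.+1,
              diff E k.+1 (esym (addrK r%:Z l)) x = 0
          & lmod_iso (page E l r k) (subquo (Phi l k) (Phi (l - 1) k))]].

Record filtered_complex := FilteredComplex {
  fcomplex :> complex;
  filt : int -> forall k, submod (fcomplex k);
  filt_le : forall l l' k x, l <= l' -> x \in filt l k -> x \in filt l' k;
  filt_bnd : forall l k x, x \in filt l k -> bnd fcomplex k x \in filt l k.-1 }.

Section SpectralSequence.
Variable C : filtered_complex.
Implicit Types (l r : int) (k : nat).
Local Notation F := (filt C).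
Local Notation d := (bnd C).

Lemma cycles_closed l r k :
  submod_closed [pred x | (x \in F l k) && (d k x \in F (l - r) k.-1)].
Proof.
split=> [|a x y]; rewrite !inE ?raddf0 ?rpred0 // => /andP[Fx Fdx] /andP[Fy Fdy].
by rewrite linearP !rpredD ?rpredZ.
Qed.
Definition cycles l r k : submod (C k) := Submod (cycles_closed l r k).

Lemma cyclesP l r k x :
  reflect (x \in F l k /\ d k x \in F (l - r) k.-1) (x \in cycles l r k).
Proof. exact: andP. Qed.

Lemma boundaries_closed l r k : submod_closed [pred x |
  `[< exists (a : C k) (b : C k.+1), [/\ a \in cycles (l - 1) (r - 1) k,
        b \in cycles (l + r - 1) (r - 1) k.+1 & x = a + d k.+1 b] >]].
Proof.
split=> [|c _ _ /asboolP[a][b][Za Zb ->] /asboolP[a'][b'][Za' Zb' ->]];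
  apply/asboolP.
  by exists 0, 0; rewrite !rpred0 raddf0 addr0.
exists (c *: a + a'), (c *: b + b'); rewrite !rpredD ?rpredZ //; split=> //.
by rewrite linearP scalerDr addrACA.
Qed.
Definition boundaries l r k : submod (C k) := Submod (boundaries_closed l r k).

Lemma boundariesP l r k x :
  reflect (exists (a : C k) (b : C k.+1), [/\ a \in cycles (l - 1) (r - 1) k,
             b \in cycles (l + r - 1) (r - 1) k.+1 & x = a + d k.+1 b])
    (x \in boundaries l r k).
Proof. exact: asboolP. Qed.

(* E^r_l = Z^r_l / (Z^(r-1)_(l-1) + d Z^(r-1)_(l+r-1)) with
   Z^r_l = {x in F_l | d x in F_(l-r)}. Cycles are indexed by an integer r so
   that this also covers r = 0, where it is F_l / F_(l-1). *)
Definition fpage l (r k : nat) : lmodType R :=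
  subquo (cycles l r k) (boundaries l r k).

Section PageDifferential.
Variables (l l' : int) (r k : nat) (h : l' = l - r%:Z).

Lemma bnd_cycles x : x \in cycles l r k -> d k x \in cycles l' r k.-1.
Proof.
by rewrite h => /cyclesP[_ Fdx]; apply/cyclesP; rewrite bndK rpred0.
Qed.

Lemma bnd_boundaries x : x \in cycles l r k -> x \in boundaries l r k ->
  d k x \in boundaries l' r k.-1.
Proof.
move=> _ /boundariesP[a][b][Za _ ->].
rewrite linearD (bndSK b) addr0.
case: k a {b} Za => [|n] a Za; first by rewrite bnd0 rpred0.
apply/boundariesP; exists 0, a; rewrite rpred0 add0r; split=> //=.
by rewrite h subrK.
Qed.

Definition fdiff : {linear fpage l r k -> fpage l' r k.-1} :=
  subquo_map bnd_cycles bnd_boundaries.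

Lemma fdiffE x : fdiff (subquo_class _ _ x) =
  subquo_class _ _ (submod_map bnd_cycles x).
Proof. exact: subquo_mapE. Qed.
End PageDifferential.

Lemma fdiff0 l l' (r : nat) (h : l' = l - r%:Z) (x : fpage l r 0) :
  fdiff 0 h x = 0.
Proof.
have [y ->] := subquo_classP x; rewrite fdiffE -(raddf0 (subquo_class _ _)).
by congr (subquo_class _ _ _); apply: val_inj; rewrite /= bnd0.
Qed.

Lemma fdiffK l l' l'' (r k : nat) (h : l' = l - r%:Z) (h' : l'' = l' - r%:Z)
  (x : fpage l r k) : fdiff k.-1 h' (fdiff k h x) = 0.
Proof.
have [y ->] := subquo_classP x; rewrite !fdiffE -(raddf0 (subquo_class _ _)).
by congr (subquo_class _ _ _); apply: val_inj; rewrite /= bndK.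
Qed.

Lemma boundary_lift l (r k : nat) (x : C k) :
  d k x \in boundaries (l - r%:Z) r k.-1 ->
  exists2 b, b \in cycles (l - 1) (r%:Z - 1) k &
    d k (x - b) \in F (l - r.+1%:Z) k.-1.
Proof.
case: k x => [|k] x => [_|/boundariesP[a][b] /=].
  by exists 0; rewrite ?bnd0 rpred0.
rewrite subrK -addrA -opprD -PoszD addn1 => -[/cyclesP[Fa _] Zb xE].
by exists b; rewrite // linearB /= xE addrK.
Qed.

Section NextPage.
Variables (l : int) (r k : nat).
Local Notation hin := (esym (addrK r%:Z l)).
Local Notation hout := (erefl (l - r%:Z)).
Local Notation next_homology :=
  (@homology (fpage (l + r%:Z) r k.+1) (fpage l r k) (fpage (l - r%:Z) r k.-1)
    (fdiff k.+1 hin) (fdiff k hout)).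

Lemma cyclesS x : x \in cycles l r.+1 k -> x \in cycles l r k.
Proof.
move=> /cyclesP[Fx Fdx]; apply/cyclesP; split=> //.
by apply: filt_le Fdx; rewrite lerD2l lerN2 lez_nat.
Qed.

Definition cycle_cast (x : submod_type (cycles l r.+1 k)) :
  submod_type (cycles l r k) := SubmodType (cyclesS (submod_valP x)).

Lemma cycle_cast_ker x :
  subquo_class _ (boundaries l r k) (cycle_cast x) \in ker (fdiff k hout).
Proof.
apply/kerP; rewrite fdiffE; apply/subquo_class0P => /=.
have /cyclesP[Fx Fdx] := submod_valP x.
apply/boundariesP; exists (d k (submod_val x)), 0; rewrite rpred0 raddf0 addr0.
split=> //; apply/cyclesP; rewrite bndK rpred0; split=> //.
by apply: filt_le Fdx; rewrite -addn1 PoszD opprD addrA.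
Qed.

Definition fnext_pre (x : submod_type (cycles l r.+1 k)) : next_homology :=
  subquo_class _ _ (SubmodType (cycle_cast_ker x)).

Lemma fnext_pre_linear : linear fnext_pre.
Proof.
move=> a x y; rewrite /fnext_pre -linearP; congr (subquo_class _ _ _).
apply: val_inj; rewrite /= -linearP; congr (subquo_class _ _ _).
exact: val_inj.
Qed.

HB.instance Definition _ := GRing.isLinear.Build R
  (submod_type (cycles l r.+1 k)) next_homology _ fnext_pre fnext_pre_linear.

Let subS1 : r.+1%:Z - 1 = r%:Z.
Proof. by rewrite -addn1 PoszD addrK. Qed.

Let addS1 : l + r.+1%:Z - 1 = l + r%:Z.
Proof. by rewrite -addrA subS1. Qed.

Lemma fnext_preP x : reflect (fnext_pre x = 0) (val x \in boundaries l r.+1 k).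
Proof.
have /cyclesP[Fx Fdx] := submod_valP x.
apply: (iffP idP) => [/boundariesP[a][b][/cyclesP[Fa Fda] /cyclesP[Fb Fdb] eqx]|].
  apply/subquo_class0P/imP.
  have Zb : b \in cycles (l + r%:Z) r k.+1.
    apply/cyclesP; split; first by rewrite -addS1.
    rewrite addrK.
    have -> : d k.+1 b = submod_val x - a by rewrite eqx addrC addKr.
    by rewrite rpredB //; apply: filt_le Fa; rewrite gerBl.
  exists (subquo_class _ _ (SubmodType Zb)); rewrite fdiffE.
  apply/esym/subquo_class_eqP => /=; rewrite eqx addrK.
  apply/boundariesP; exists a, 0; rewrite rpred0 raddf0 addr0; split=> //.
  apply/cyclesP; split=> //; apply: filt_le Fda.
  by rewrite subS1 opprB addrA subrK addrAC gerBl.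
move=> /subquo_class0P/imP[y].
have [z ->] := subquo_classP y; rewrite fdiffE.
move=> /esym /subquo_class_eqP /= /boundariesP[a][b][/cyclesP[Fa Fda]].
move=> /cyclesP[Fb Fdb] eqx.
have /cyclesP[Fz Fdz] := submod_valP z.
have xE : submod_val x = a + d k.+1 (submod_val z + b).
  by rewrite linearD addrCA -eqx addrC subrK.
apply/boundariesP; exists a, (submod_val z + b); split=> //.
  apply/cyclesP; split=> //.
  have -> : d k a = d k (submod_val x).
    by rewrite xE linearD bndSK addr0.
  by rewrite subS1 addrAC -addrA -opprD -PoszD addn1.
rewrite addS1 subS1; apply/cyclesP; split.
  by apply: rpredD => //; apply: filt_le Fb; rewrite gerBl.
rewrite linearD; apply: rpredD => //; apply: filt_le Fdb.
by rewrite opprB addrA subrK addrK.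
Qed.

Definition fnext : {linear fpage l r.+1 k -> next_homology} :=
  subquo_lift (fun x => elimT (fnext_preP x)).

Lemma fnext_bij : bijective fnext.
Proof.
apply: inj_surj_bij => [x y|y].
  have [u ->] := subquo_classP x; have [v ->] := subquo_classP y.
  rewrite /fnext !subquo_liftE => /eqP.
  rewrite -subr_eq0 -linearB => /eqP/fnext_preP uv.
  by apply/subquo_class_eqP; rewrite -linearB.
have [[w wk] ->] := subquo_classP y.
have [x xw] := subquo_classP w; rewrite xw in wk *.
have /cyclesP[Fx Fdx] := submod_valP x.
have /kerP := wk; rewrite fdiffE => /subquo_class0P /boundary_lift[b Zb Fdb].
have /cyclesP[Fb _] := Zb.
have Zxb : submod_val x - b \in cycles l r.+1 k.
  by apply/cyclesP; split=> //; apply: rpredB => //; apply: filt_le Fb; rewrite gerBl.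
exists (subquo_class _ _ (SubmodType Zxb)).
rewrite /fnext subquo_liftE; congr (subquo_class _ _ _); apply: val_inj.
apply/subquo_class_eqP; rewrite /= addrAC subrr add0r.
apply/boundariesP; exists (- b), 0; rewrite rpred0 raddf0 addr0; split=> //.
by rewrite rpredN.
Qed.
End NextPage.

Definition spectral_sequence : spectral_seq :=
  SpectralSeq fdiff0 fdiffK fnext_bij.
End SpectralSequence.
End Subquotients.

Section FreeModules.
Variable R : comPzRingType.

Definition free (T : finType) : lmodType R := {ffun T -> R^o}.

Definition gen (T : finType) (x : T) : free T := [ffun y => (y == x)%:R].

Definition ogen (T : finType) (o : option T) : free T :=
  if o is Some x then gen x else 0.

Lemma ogenE (T : finType) (o : option T) z : ogen o z = (o == Some z)%:R.
Proof. by case: o => [x|]; rewrite /= ffunE // -[RHS]/((x == z)%:R) eq_sym. Qed.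

Section Extension.
Variables (T : finType) (N : lmodType R) (f : T -> N).

Definition extend_fun (c : free T) : N := \sum_x (c x : R) *: f x.

Lemma extend_linear : linear extend_fun.
Proof.
move=> a b c; rewrite /extend_fun scaler_sumr -big_split /=.
by apply: eq_bigr => x _; rewrite !ffunE scalerDl scalerA.
Qed.

HB.instance Definition _ :=
  GRing.isLinear.Build R (free T) N _ extend_fun extend_linear.

Definition extend : {linear free T -> N} := extend_fun.

Lemma extendE x : extend (gen x) = f x.
Proof.
rewrite /extend /= /extend_fun (bigD1 x) //= ffunE eqxx scale1r big1 ?addr0 //.
by move=> y /negPf yx; rewrite ffunE yx scale0r.
Qed.
End Extension.

Lemma free_sum (T : finType) (c : free T) : c = \sum_x (c x : R) *: gen x.
Proof.
apply/ffunP => z; rewrite sum_ffunE (bigD1 z) //= !ffunE eqxx.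
rewrite big1 ?addr0 => [|y /negPf zy]; first by rewrite [RHS]mulr1.
by rewrite !ffunE eq_sym zy [LHS]mulr0.
Qed.

Lemma free_ext (T : finType) (N : lmodType R) (f g : {linear free T -> N}) :
  (forall x, f (gen x) = g (gen x)) -> forall c, f c = g c.
Proof.
move=> fg c; rewrite [c]free_sum !linear_sum.
by apply: eq_bigr => x _; rewrite !linearZ /= fg.
Qed.

Section Support.
Variables (T : finType) (P : pred T).

Lemma supported_closed :
  submod_closed [pred c : free T | [forall x, (c x != 0) ==> P x]].
Proof.
split=> [|a b c]; rewrite !inE.
  by apply/forallP => x; rewrite ffunE eqxx.
move=> /forallP Pb /forallP Pc; apply/forallP => x; rewrite !ffunE.
have := Pb x; have := Pc x; case: (P x); rewrite ?implybT // !implybF !negbK.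
by move=> /eqP -> /eqP ->; rewrite addr0 [_ *: _]mulr0.
Qed.

Definition supported : submod (free T) := Submod supported_closed.

Lemma supportedP (c : free T) :
  reflect (forall x, c x != 0 -> P x) (c \in supported).
Proof.
apply: (iffP forallP) => h x; [exact: implyP (h x) | exact: introT implyP (h x)].
Qed.

Lemma supported_gen x : P x -> gen x \in supported.
Proof.
move=> Px; apply/supportedP => y; rewrite ffunE.
by case: (eqVneq y x) => [->|]; rewrite ?eqxx.
Qed.
End Support.

Lemma extend_supported (T T' : finType) (P : pred T) (P' : pred T')
    (f : T -> free T') (c : free T) :
  (forall x, P x -> f x \in supported P') ->
  c \in supported P -> extend f c \in supported P'.
Proof.
move=> Pf /supportedP Pc; apply: rpred_sum => x _.
have [->|/Pc/Pf] := eqVneq (c x) 0; first by rewrite scale0r rpred0.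
exact: rpredZ.
Qed.

End FreeModules.

Record semi_sset := SemiSSet {
  semi_simplex :> nat -> finType;
  sface : forall n, 'I_n.+2 -> semi_simplex n.+1 -> semi_simplex n;
  sfaceK : forall n (i j : 'I_n.+2) (x : semi_simplex n.+2), (i <= j)%N ->
    sface i (sface (lift ord0 j) x) =
    sface j (sface (widen_ord (leqnSn n.+2) i) x) }.

Lemma alternating_sum0 (V : zmodType) (n : nat) (Q : 'I_n.+2 -> 'I_n.+3 -> bool)
    (g : 'I_n.+2 -> 'I_n.+3 -> V) :
  (forall i j : 'I_n.+2, (i <= j)%N ->
     Q i (lift ord0 j) = Q j (widen_ord (leqnSn n.+2) i)) ->
  (forall i j : 'I_n.+2, (i <= j)%N ->
     g i (lift ord0 j) + g j (widen_ord (leqnSn n.+2) i) = 0) ->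
  \sum_j \sum_(i | Q i j) g i j = 0.
Proof.
move=> eqQ eqg; pose G i j := if Q i j then g i j else 0.
have -> : \sum_j \sum_(i | Q i j) g i j = \sum_i \sum_j G i j.
  by rewrite exchange_big; apply: eq_bigr => j _; rewrite -big_mkcond.
have split_sum i : \sum_j G i j = \sum_(j : 'I_n.+2 | (i <= j)%N) G i (lift ord0 j) +
    \sum_(j : 'I_n.+2 | (j <= i)%N) G i (widen_ord (leqnSn n.+2) j).
  rewrite (bigID (fun j : 'I_n.+3 => (i < j)%N)) /=; congr (_ + _).
    by rewrite big_mkcond big_ord_recl /= add0r -big_mkcond.
  rewrite big_mkcond big_ord_recr /= ltn_ord addr0 -big_mkcond.
  by apply: eq_bigl => j; rewrite -leqNgt.
rewrite (eq_bigr _ (fun i _ => split_sum i)) big_split /=.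
rewrite [X in _ + X](exchange_big_dep xpredT) //= -big_split big1 //= => i _.
rewrite -big_split big1 //= => j le_ij.
by rewrite /G eqQ //; case: ifP => _; rewrite ?eqg ?addr0.
Qed.

Section Chains.
Variable R : comPzRingType.

Section PartialChains.
Variables (X : semi_sset) (P : forall n, pred (X n)).
Variable sel : forall n, pred 'I_n.+2.

(* Generators are the simplices in P. Only the faces selected by sel enter the
   boundary, and a face outside P counts as 0. *)
Definition pchain_mod (n : nat) : lmodType R := free R {x : X n | P x}.

Definition pchain_gen_bnd n (x : {x : X n.+1 | P x}) : pchain_mod n :=
  \sum_(i | sel i) (-1) ^+ i *: ogen R (insub (sface i (val x))).

Definition pchain_bnd n : {linear pchain_mod n -> pchain_mod n.-1} :=
  match n with
  | 0 => \0
  | m.+1 => extend (@pchain_gen_bnd m)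
  end.

Hypothesis selK : forall n (i j : 'I_n.+2), (i <= j)%N ->
  sel i && sel (lift ord0 j) = sel j && sel (widen_ord (leqnSn n.+2) i).
Hypothesis badP : forall n (x : X n.+2) (i : 'I_n.+3) (z : X n),
  P x -> sel i -> ~~ P (sface i x) -> P z ->
  \sum_(j | sel j) (-1) ^+ j * (sface j (sface i x) == z)%:R = 0 :> R.

Lemma pchain_bnd0 x : pchain_bnd 0 x = 0. Proof. by []. Qed.

Lemma pchain_bnd_ogen n (y : X n.+1) (z : {x : X n | P x}) :
  pchain_bnd n.+1 (ogen R (insub y)) z =
  if P y then \sum_(j | sel j) (-1) ^+ j * (sface j y == val z)%:R else 0.
Proof.
case: insubP => [u Pu uy|/negPf ->]; last by rewrite raddf0 ffunE.
rewrite Pu /= [extend _ _]extendE sum_ffunE; apply: eq_bigr => j _.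
rewrite ffunE ogenE uy; congr (_ * _%:R); congr nat_of_bool.
case: insubP => [v Pv <-|nPv]; first exact: inj_eq Some_inj _ _.
by apply/esym/negbTE; apply: contraNneq nPv => ->; apply: valP.
Qed.

Lemma pchain_bndK n x : pchain_bnd n.-1 (pchain_bnd n x) = 0.
Proof.
case: n x => [|[|n]] x; rewrite ?raddf0 //.
pose f : {linear pchain_mod n.+2 -> pchain_mod n} :=
  pchain_bnd n.+1 \o pchain_bnd n.+2.
apply: (@free_ext R _ _ f \0) => {}x.
rewrite /f /= [extend _ (gen _ _)]extendE /pchain_gen_bnd.
apply/ffunP => z; rewrite linear_sum sum_ffunE [RHS]ffunE.
pose g (i : 'I_n.+2) (j : 'I_n.+3) : R :=
  (-1) ^+ (i + j) * (sface i (sface j (val x)) == val z)%:R.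
rewrite -[RHS](@alternating_sum0 R n (fun i j => sel i && sel j) g) //.
- rewrite big_mkcond; apply: eq_bigr => j _; case: ifP => selj; last first.
    by rewrite big1 // => i /andP[_ sj]; rewrite sj in selj.
  rewrite linearZ ffunE /= [X in _ *: X](pchain_bnd_ogen (sface j (val x)) z).
  transitivity ((-1) ^+ j * \sum_(i | sel i)
      (-1) ^+ i * (sface i (sface j (val x)) == val z)%:R : R).
    case: ifP => // nP; congr (_ * _); apply/esym/badP => //.
    - exact: valP.
    - by rewrite nP.
    exact: valP.
  rewrite mulr_sumr; apply: eq_big => [i|i _]; first by rewrite andbT.
  by rewrite /g mulrA -exprD addnC.
- exact: selK.
move=> i j le_ij; rewrite /g sfaceK //= /bump leq0n add1n addnS exprS.
by rewrite addnC !mulN1r mulNr addNr.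
Qed.

Definition pchains : complex R := Complex pchain_bnd0 pchain_bndK.
End PartialChains.

Section AllChains.
Variable X : semi_sset.

Definition chain_bnd n : {linear free R (X n) -> free R (X n.-1)} :=
  match n with
  | 0 => \0
  | m.+1 => extend (fun x : X m.+1 => \sum_(i < m.+2) (-1) ^+ i *: gen R (sface i x))
  end.

Lemma chain_bnd0 x : chain_bnd 0 x = 0. Proof. by []. Qed.

Lemma chain_bndK n x : chain_bnd n.-1 (chain_bnd n x) = 0.
Proof.
case: n x => [|[|n]] x; rewrite ?raddf0 //.
pose f : {linear free R (X n.+2) -> free R (X n)} :=
  chain_bnd n.+1 \o chain_bnd n.+2.
apply: (@free_ext R _ _ f \0) => {}x.
rewrite /f /= [extend _ (gen _ x)]extendE linear_sum [RHS]/=.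
pose g (i : 'I_n.+2) (j : 'I_n.+3) : free R (X n) :=
  (-1) ^+ (i + j) *: gen R (sface i (sface j x)).
rewrite -[RHS](@alternating_sum0 _ n (fun _ _ => true) g) //.
  apply: eq_bigr => j _; rewrite linearZ /= [extend _ _]extendE scaler_sumr.
  by apply: eq_bigr => i _; rewrite scalerA -exprD addnC.
move=> i j le_ij; rewrite /g sfaceK //= /bump leq0n add1n addnS exprS.
by rewrite addnC mulN1r scaleNr addNr.
Qed.

Definition chains : complex R := Complex chain_bnd0 chain_bndK.
End AllChains.

Section Subcomplex.
Variables (C : complex R) (S : forall k, submod (C k)).
Hypothesis S_bnd : forall k x, x \in S k -> bnd C k x \in S k.-1.

Definition subcomplex_bnd_fun k (x : submod_type (S k)) : submod_type (S k.-1) :=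
  submod_map (@S_bnd k) x.

Lemma subcomplex_bnd_linear k : linear (@subcomplex_bnd_fun k).
Proof. by move=> a x y; apply: val_inj; rewrite /= linearP. Qed.

HB.instance Definition _ k := GRing.isLinear.Build R (submod_type (S k))
  (submod_type (S k.-1)) _ (@subcomplex_bnd_fun k) (@subcomplex_bnd_linear k).

Definition subcomplex_bnd k :
  {linear submod_type (S k) -> submod_type (S k.-1)} := @subcomplex_bnd_fun k.

Lemma subcomplex_bnd0 x : subcomplex_bnd 0 x = 0.
Proof. by apply: val_inj; rewrite /= bnd0. Qed.

Lemma subcomplex_bndK k x : subcomplex_bnd k.-1 (subcomplex_bnd k x) = 0.
Proof. by apply: val_inj; rewrite /= bndK. Qed.

Definition subcomplex : complex R :=
  @Complex R (fun k => submod_type (S k) : lmodType R) subcomplex_bnd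
    subcomplex_bnd0 subcomplex_bndK.
End Subcomplex.
End Chains.

Record order_map (m n : nat) := OrderMap {
  order_map_fun :> 'I_m.+1 -> 'I_n.+1;
  order_mapP : forall i j : 'I_m.+1,
    (i <= j)%N -> (order_map_fun i <= order_map_fun j)%N }.

Lemma order_map_ext m n (f g : order_map m n) : (forall i, f i = g i) -> f = g.
Proof.
case: f g => [f fP] [g gP] /= /funext fg; case: _ / fg gP => gP.
by rewrite (Prop_irrelevance fP gP).
Qed.

Definition id_order n : order_map n n := @OrderMap n n id (fun i j le_ij => le_ij).

Definition comp_order m n p (f : order_map n p) (g : order_map m n) :
    order_map m p :=
  @OrderMap m p (fun i => f (g i))
    (fun i j le_ij => order_mapP f (order_mapP g le_ij)).

Lemma coface_subproof n (i : 'I_n.+2) (j k : 'I_n.+1) :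
  (j <= k)%N -> (lift i j <= lift i k)%N.
Proof. by rewrite /= leq_bump2. Qed.

Definition coface n (i : 'I_n.+2) : order_map n n.+1 :=
  OrderMap (@coface_subproof n i).

Definition merge n (i : 'I_n.+1) (j : 'I_n.+2) : 'I_n.+1 :=
  inord (if (j <= i)%N then j : nat else j.-1).

Lemma mergeE n (i : 'I_n.+1) (j : 'I_n.+2) :
  merge i j = (if (j <= i)%N then j : nat else j.-1) :> nat.
Proof.
by rewrite inordK //; case: ifP; have := ltn_ord i; have := ltn_ord j; lia.
Qed.

Lemma codegen_subproof n (i : 'I_n.+1) (j k : 'I_n.+2) :
  (j <= k)%N -> (merge i j <= merge i k)%N.
Proof.
by rewrite !mergeE; case: ifP; case: ifP; lia.
Qed.

Definition codegen n (i : 'I_n.+1) : order_map n.+1 n :=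
  OrderMap (@codegen_subproof n i).

(* sact makes simplex a contravariant functor on the simplex category *)
Record sset := SSet {
  simplex :> nat -> finType;
  sact : forall m n, order_map m n -> simplex n -> simplex m;
  sact_id : forall n (x : simplex n), sact (id_order n) x = x;
  sact_comp : forall m n p (f : order_map n p) (g : order_map m n) x,
    sact (comp_order f g) x = sact g (sact f x) }.

Record sub_sset (X : sset) := SubSSet {
  in_sub_sset :> forall n, pred (X n);
  sub_sset_act : forall m n (f : order_map m n) x,
    in_sub_sset x -> in_sub_sset (sact f x) }.

Section SSetTheory.
Variable X : sset.

Definition degeneracy n (i : 'I_n.+1) (x : X n) : X n.+1 := sact (codegen i) x.

Definition degenerate n : pred (X n) :=
  match n with
  | 0 => pred0
  | m.+1 => [pred x : X m.+1 |
              [exists i : 'I_m.+1, exists y : X m, x == degeneracy i y]]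
  end.

Definition face n (i : 'I_n.+2) (x : X n.+1) : X n := sact (coface i) x.

Lemma sact_eq m n (f g : order_map m n) (x : X n) :
  (forall i, f i = g i) -> sact f x = sact g x.
Proof. by move/order_map_ext->. Qed.

Lemma faceK n (i j : 'I_n.+2) (x : X n.+2) : (i <= j)%N ->
  face i (face (lift ord0 j) x) = face j (face (widen_ord (leqnSn n.+2) i) x).
Proof.
move=> le_ij; rewrite /face -!sact_comp; apply: sact_eq => k.
apply: val_inj.
by rewrite /= /bump; do ?[case: ifP]; lia.
Qed.

Definition semi_of_sset : semi_sset := SemiSSet faceK.

Lemma noninj_degenerate m n (f : order_map m.+1 n) (y : X n) (i : 'I_m.+1) :
  f (widen_ord (leqnSn m.+1) i) = f (lift ord0 i) -> degenerate (sact f y).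
Proof.
move=> fi; apply/existsP; exists i; apply/existsP.
exists (sact (comp_order f (coface (lift ord0 i))) y); apply/eqP.
rewrite /degeneracy -!sact_comp; apply: sact_eq => j.
have [ji|ji] := eqVneq j (lift ord0 i).
  rewrite ji -fi; congr (f _); apply: val_inj.
  by rewrite /= /bump mergeE /= /bump; do ?[case: ifP]; lia.
congr (f _); apply: val_inj; move: ji.
by rewrite -val_eqE /= /bump mergeE /=; do ?[case: ifP]; lia.
Qed.

Lemma face_degeneracy_degenerate n (a : 'I_n.+2) (j : 'I_n.+1) (w : X n) :
  a != j :> nat -> a != j.+1 :> nat -> degenerate (face a (degeneracy j w)).
Proof.
case: n a j w => [|m] a j w aj aj1.
  by have := ltn_ord a; have := ltn_ord j; lia.
rewrite /face /degeneracy -sact_comp.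
have km : ((if a < j then j.-1 else j) < m.+1)%N.
  by case: ifP; have := ltn_ord a; have := ltn_ord j; lia.
apply: (@noninj_degenerate _ _ _ _ (Ordinal km)); apply: val_inj.
by rewrite /= !mergeE /= /bump /=; do ?[case: ifP]; lia.
Qed.

Lemma face_degeneracy n (a : 'I_n.+2) (j : 'I_n.+1) (w : X n) :
  (a == j :> nat) || (a == j.+1 :> nat) -> face a (degeneracy j w) = w.
Proof.
move=> aj; rewrite /face /degeneracy -sact_comp -[RHS]sact_id.
apply: sact_eq => k; apply: val_inj.
by rewrite /= !mergeE /= /bump /=; do ?[case: ifP]; lia.
Qed.

Variable R : comPzRingType.

Lemma degenerate_bnd n (y : X n.+1) (z : X n) : degenerate y -> ~~ degenerate z ->
  \sum_(j < n.+2) (-1) ^+ j * (face j y == z)%:R = 0 :> R.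
Proof.
move=> /existsP[j /existsP[w /eqP ->]] nz.
rewrite (bigD1 (widen_ord (leqnSn n.+1) j)) //= (bigD1 (lift ord0 j)) /=; last first.
  by rewrite -val_eqE /= /bump; lia.
rewrite !face_degeneracy ?eqxx ?orbT //= big1 ?addr0 => [|a /andP[aj aj1]].
  by rewrite /bump leq0n add1n exprS -mulrDl mulN1r addrN mul0r.
have [za|] := eqVneq; last by rewrite mulr0.
move: nz; rewrite -za face_degeneracy_degenerate //.
Qed.

Section Normalized.
Variable S : sub_sset X.

Definition nondegenerate_in n : pred (X n) := [pred x | S n x && ~~ degenerate x].

Lemma normalized_sel n (i j : 'I_n.+2) : (i <= j)%N ->
  xpredT i && xpredT (lift ord0 j) = xpredT j && xpredT (widen_ord (leqnSn n.+2) i).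
Proof. by []. Qed.

Lemma normalized_bad n (x : X n.+2) (i : 'I_n.+3) (z : X n) :
  nondegenerate_in x -> true -> ~~ nondegenerate_in (face i x) ->
  nondegenerate_in z ->
  \sum_(j : 'I_n.+2 | xpredT j) (-1) ^+ j * (face j (face i x) == z)%:R = 0 :> R.
Proof.
move=> /andP[Sx _] _ + /andP[_ nz]; rewrite /= negb_and negbK.
by rewrite sub_sset_act //= => /degenerate_bnd; apply.
Qed.

(* Normalised chains of S: free on its nondegenerate simplices, degenerate faces
   counting as 0 *)
Definition normalized_chains : complex R :=
  @pchains R semi_of_sset nondegenerate_in (fun n => xpredT) normalized_sel
    normalized_bad.

Section Filtration.
Variable F : int -> sub_sset X.
Hypothesis F_le : forall l l' n (x : X n), l <= l' -> F l n x -> F l' n x.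

Definition chain_filt (l : int) n : submod (normalized_chains n) :=
  supported R [pred x : {x : X n | nondegenerate_in x} | F l n (val x)].

Lemma chain_filt_le l l' n x :
  l <= l' -> x \in chain_filt l n -> x \in chain_filt l' n.
Proof.
move=> le_l /supportedP Fx; apply/supportedP => y /Fx.
exact: F_le le_l.
Qed.

Lemma chain_filt_bnd l n x :
  x \in chain_filt l n -> bnd normalized_chains n x \in chain_filt l n.-1.
Proof.
case: n x => [|n] x; first by rewrite rpred0.
apply: extend_supported => y Fy; apply: rpred_sum => i _; apply: rpredZ.
case: insubP => [z _ zy|_]; last exact: rpred0.
by apply: supported_gen; rewrite /= zy; apply: sub_sset_act.
Qed.

Definition filtered_chains : filtered_complex R :=
  FilteredComplex chain_filt_le chain_filt_bnd.
End Filtration.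
End Normalized.

(* The chain map sending a simplex of S to the same simplex of S' (used for S
   contained in S') *)
Definition normalized_incl (S S' : sub_sset X) n :
    {linear normalized_chains S n -> normalized_chains S' n} :=
  extend (fun x : {x : X n | nondegenerate_in S x} =>
    ogen R (insub (val x) : option {x : X n | nondegenerate_in S' x})).

End SSetTheory.

Section Tuples.
Variable V : finType.

Definition vtuple (n : nat) : finType := {ffun 'I_n.+1 -> V}.

Definition del n (i : 'I_n.+2) (x : vtuple n.+1) : vtuple n :=
  [ffun j => x (lift i j)].

Lemma delK n (i j : 'I_n.+2) (x : vtuple n.+2) : (i <= j)%N ->
  del i (del (lift ord0 j) x) = del j (del (widen_ord (leqnSn n.+2) i) x).
Proof.
move=> le_ij; apply/ffunP => k; rewrite !ffunE; congr (x _); apply: val_inj.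
by rewrite /= /bump; lia.
Qed.

Definition tuple_sset : semi_sset := SemiSSet delK.

Definition pull m n (f : 'I_m.+1 -> 'I_n.+1) (x : vtuple n) : vtuple m :=
  [ffun j => x (f j)].

Definition src n (i : 'I_n) : 'I_n.+1 := widen_ord (leqnSn n) i.
Definition tgt n (i : 'I_n) : 'I_n.+1 := lift ord0 i.

End Tuples.

Section Digraph.
Variables (V : finType) (E : rel V).

Definition walk (n : nat) (x y : V) : bool :=
  [exists p : n.-tuple V, path E x p && (last x p == y)].

Lemma walkP n x y :
  reflect (exists p, [/\ size p = n, path E x p & last x p = y]) (walk n x y).
Proof.
apply: (iffP existsP) => [[p /andP[xp /eqP yp]]|[p [sp xp yp]]].
  by exists p; rewrite size_tuple.
by exists (Tuple (introT eqP sp)); rewrite /= xp yp eqxx.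
Qed.

Lemma connect_walk x y : connect E x y -> exists n, walk n x y.
Proof. by case/connectP => p xp ->; exists (size p); apply/walkP; exists p. Qed.

(* None stands for infinity *)
Definition dist (x y : V) : option nat :=
  match @idP (connect E x y) with
  | ReflectT xy => Some (ex_minn (connect_walk xy))
  | ReflectF _ => None
  end.

Lemma walk_connect n x y : walk n x y -> connect E x y.
Proof. by case/walkP => p [_ xp <-]; apply/connectP; exists p. Qed.

Lemma dist_walk n x y : dist x y = Some n -> walk n x y.
Proof.
by rewrite /dist; case: {-}_ / idP => // xy [<-]; case: ex_minnP.
Qed.

Lemma dist_le n x y : walk n x y -> exists2 c, dist x y = Some c & (c <= n)%N.
Proof.
move=> xy; rewrite /dist; case: {-}_ / idP => [cxy|[]]; last exact: walk_connect xy.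
by case: ex_minnP => c _ min_c; exists c => //; apply: min_c.
Qed.

Lemma dist_xx x : dist x x = Some 0.
Proof.
have /dist_le[c -> ] : walk 0 x x by apply/walkP; exists [::].
by rewrite leqn0 => /eqP ->.
Qed.

Lemma dist_triangle x y z a b : dist x y = Some a -> dist y z = Some b ->
  exists2 c, dist x z = Some c & (c <= a + b)%N.
Proof.
move=> /dist_walk/walkP[p [sp xp yp]] /dist_walk/walkP[q [sq yq zq]].
apply: dist_le; apply/walkP; exists (p ++ q).
by rewrite size_cat sp sq cat_path last_cat xp yp.
Qed.

Definition dist_steps n (x : vtuple V n) : bool :=
  [forall i : 'I_n, dist (x (src i)) (x (tgt i)) != None].

(* None when some distance is infinite *)
Definition len n (x : vtuple V n) : option nat :=
  if dist_steps x
  then Some (\sum_(i < n) odflt 0 (dist (x (src i)) (x (tgt i))))%N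
  else None.

Definition prefix_len n (x : vtuple V n) (k : nat) : nat :=
  (\sum_(i < n | i < k) odflt 0 (dist (x (src i)) (x (tgt i))))%N.

Lemma prefix_lenS n (x : vtuple V n) (i : 'I_n) :
  prefix_len x i.+1 =
  (prefix_len x i + odflt 0 (dist (x (src i)) (x (tgt i))))%N.
Proof.
rewrite /prefix_len (bigD1 i) //= addnC; congr (_ + _)%N.
by apply: eq_bigl => j; rewrite ltnS -val_eqE /= ltn_neqAle andbC.
Qed.

Lemma prefix_len_le n (x : vtuple V n) k k' :
  (k <= k')%N -> (prefix_len x k <= prefix_len x k')%N.
Proof.
move=> le_k; rewrite /prefix_len big_mkcond [leqRHS]big_mkcond.
by apply: leq_sum => i _; case: ifP => // ik; rewrite (leq_trans ik).
Qed.

Lemma prefix_len_max n (x : vtuple V n) : dist_steps x ->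
  len x = Some (prefix_len x n).
Proof.
move=> xP; rewrite /len xP; congr Some.
by apply: eq_bigl => i; rewrite ltn_ord.
Qed.

Lemma dist_prefix n (x : vtuple V n) (i j : 'I_n.+1) :
  dist_steps x -> (i <= j)%N ->
  exists2 c, dist (x i) (x j) = Some c & (prefix_len x i + c <= prefix_len x j)%N.
Proof.
move=> /forallP xP; case: j => j /=; elim: j => [|j IHj] lt_jn le_ij.
  have -> : Ordinal lt_jn = i by apply: val_inj; move: le_ij; rewrite leqn0 => /eqP.
  by exists 0%N; rewrite ?dist_xx // addn0; move: le_ij; rewrite leqn0 => /eqP ->.
move: le_ij; rewrite leq_eqVlt => /predU1P[ij|].
  have -> : Ordinal lt_jn = i by apply: val_inj.
  by exists 0%N; rewrite ?dist_xx // addn0 ij.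
rewrite ltnS => /(IHj (ltnW lt_jn))[c xc le_c].
pose k := Ordinal (lt_jn : (j < n)%N).
have [b xb] : exists b, dist (x (src k)) (x (tgt k)) = Some b.
  by have := xP k; case: dist => // b _; exists b.
have e1 : src k = Ordinal (ltnW lt_jn) by apply: val_inj.
have e2 : tgt k = Ordinal lt_jn by apply: val_inj.
rewrite e1 e2 in xb; have [d xd le_d] := dist_triangle xc xb.
exists d => //; rewrite (prefix_lenS x k) e1 e2 xb /=.
by move: le_c le_d; rewrite /=; lia.
Qed.

Lemma pull_steps m n (f : order_map m n) (x : vtuple V n) :
  dist_steps x -> dist_steps (pull f x).
Proof.
move=> xP; apply/forallP => i; rewrite !ffunE.
have le_f : (f (src i) <= f (tgt i))%N by apply: order_mapP; rewrite /= /bump; lia.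
by have [c ->] := dist_prefix xP le_f.
Qed.

Lemma pull_prefix m n (f : order_map m n) (x : vtuple V n) (k : 'I_m.+1) :
  dist_steps x -> (prefix_len (pull f x) k <= prefix_len x (f k))%N.
Proof.
move=> xP; case: k => k /=; elim: k => [|k IHk] lt_km.
  by rewrite [X in (X <= _)%N]big_pred0.
pose i := Ordinal (lt_km : (k < m)%N); rewrite (prefix_lenS _ i) !ffunE.
have le_f : (f (src i) <= f (tgt i))%N by apply: order_mapP; rewrite /= /bump; lia.
have [c -> /=] := dist_prefix xP le_f.
have := IHk (ltnW lt_km).
have -> : Ordinal (ltnW lt_km) = src i by apply: val_inj.
have -> : Ordinal lt_km = tgt i by apply: val_inj.
by rewrite /=; lia.
Qed.

Lemma len_pull m n (f : order_map m n) (x : vtuple V n) a : len x = Some a ->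
  exists2 b, len (pull f x) = Some b & (b <= a)%N.
Proof.
move=> lx; have xP : dist_steps x by move: lx; rewrite /len; case: ifP.
move: lx; rewrite prefix_len_max // => -[<-].
exists (prefix_len (pull f x) m); first by rewrite prefix_len_max ?pull_steps.
apply: leq_trans (pull_prefix f ord_max xP) _.
by apply: prefix_len_le; rewrite -ltnS.
Qed.

Definition reach_steps n (x : vtuple V n) : bool :=
  [forall i : 'I_n, connect E (x (src i)) (x (tgt i))].

Lemma reach_connect n (x : vtuple V n) (i j : 'I_n.+1) :
  reach_steps x -> (i <= j)%N -> connect E (x i) (x j).
Proof.
move=> /forallP xP; case: j => j /=; elim: j => [|j IHj] lt_jn le_ij.
  have -> // : Ordinal lt_jn = i.
  by apply: val_inj; move: le_ij; rewrite leqn0 => /eqP.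
move: le_ij; rewrite leq_eqVlt => /predU1P[ij|].
  by have -> // : Ordinal lt_jn = i by apply: val_inj.
rewrite ltnS => /(IHj (ltnW lt_jn)) xj; apply: connect_trans xj _.
have := xP (Ordinal (lt_jn : (j < n)%N)).
by congr (connect E (x _) (x _)); apply: val_inj.
Qed.

Lemma reach_pull m n (f : order_map m n) (x : vtuple V n) :
  reach_steps x -> reach_steps (pull f x).
Proof.
move=> xP; apply/forallP => i; rewrite !ffunE; apply: reach_connect => //.
by apply: order_mapP; rewrite /= /bump; lia.
Qed.

(* A simplex of the nerve of the reachability category is determined by its
   vertices, since there is at most one morphism between two objects. *)
Definition nerve_simplex n : finType := {x : vtuple V n | reach_steps x}.

Definition nerve_act m n (f : order_map m n) (x : nerve_simplex n) :
  nerve_simplex m := Sub (pull f (val x)) (reach_pull f (valP x)).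

Lemma nerve_act_id n (x : nerve_simplex n) : nerve_act (id_order n) x = x.
Proof. by apply: val_inj; apply/ffunP => i; rewrite ffunE. Qed.

Lemma nerve_act_comp m n p (f : order_map n p) (g : order_map m n) x :
  nerve_act (comp_order f g) x = nerve_act g (nerve_act f x).
Proof. by apply: val_inj; apply/ffunP => i; rewrite !ffunE. Qed.

Definition nerve : sset := SSet nerve_act_id nerve_act_comp.

Definition full_nerve : sub_sset nerve :=
  @SubSSet nerve (fun n => xpredT) (fun m n f x _ => isT).

(* The simplicial subset generated by the tuples of pairwise distinct vertices;
   its nondegenerate simplices are exactly these tuples (nondegenerate_inj_nerve),
   which characterizes it. *)
Definition in_inj_nerve n (x : nerve n) : bool :=
  `[< exists m (f : order_map n m) (y : nerve m),
        injective (val y : vtuple V m) /\ x = sact f y >].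

Lemma in_inj_nerve_act m n (f : order_map m n) (x : nerve n) :
  in_inj_nerve x -> in_inj_nerve (sact f x).
Proof.
move=> /asboolP[p [g [y [y_inj ->]]]]; apply/asboolP.
by exists p, (comp_order g f), y; rewrite sact_comp.
Qed.

Definition inj_nerve : sub_sset nerve := SubSSet in_inj_nerve_act.

Lemma order_map_noninj m n (f : order_map m.+1 n) : ~ injective f ->
  exists i : 'I_m.+1, f (src i) = f (tgt i).
Proof.
move=> nf; apply: contrapT => fi; apply: nf.
have lt_f (i j : 'I_m.+2) : (i < j)%N -> (f i < f j)%N.
  case: j => j; elim: j => //= j IHj lt_jm; rewrite ltnS => le_ij.
  pose k := Ordinal (lt_jm : (j < m.+1)%N).
  have e1 : src k = Ordinal (ltnW lt_jm) by apply: val_inj.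
  have e2 : tgt k = Ordinal lt_jm by apply: val_inj.
  have lt_k : (f (src k) < f (tgt k))%N.
    rewrite ltn_neqAle; apply/andP; split.
      by apply/eqP => /val_inj fk; apply: fi; exists k.
    by apply: order_mapP; rewrite e1 e2.
  rewrite e1 e2 in lt_k; move: le_ij; rewrite leq_eqVlt => /predU1P[ij|ij].
    by have -> : i = Ordinal (ltnW lt_jm) by apply: val_inj.
  exact: ltn_trans (IHj (ltnW lt_jm) ij) lt_k.
move=> i j fij; apply: val_inj; case: (ltngtP i j) => // /lt_f;
  by rewrite fij ltnn.
Qed.

Lemma nondegenerate_inj_nerve n (x : nerve n) :
  nondegenerate_in inj_nerve x = injectiveb (val x : vtuple V n).
Proof.
apply/andP/injectiveP => [[/asboolP[m [f [y [y_inj ->]]]] nx]|x_inj].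
  have f_inj : injective f.
    case: n f x nx => [|n] f x nx; first by move=> i j _; rewrite !ord1.
    apply: contrapT => /order_map_noninj[i fi]; move/negP: nx; apply.
    exact: noninj_degenerate fi.
  by move=> i j; rewrite !ffunE => /y_inj/f_inj.
split; first by apply/asboolP; exists n, (id_order n), x; rewrite sact_id.
case: n x x_inj => [|n] x x_inj //; rewrite /degenerate /=.
apply/negP => /existsP[i /existsP[y /eqP xy]].
have /x_inj/(congr1 val)/= : val x (src i) = val x (tgt i).
  rewrite xy !ffunE; congr (val y _); apply: val_inj.
  by rewrite /= !mergeE /= /bump; do ?[case: ifP]; lia.
by rewrite /bump; lia.
Qed.

Definition len_le (l : int) n (x : vtuple V n) : bool :=
  if len x is Some a then a%:Z <= l else false.

Definition len_is (l : int) n (x : vtuple V n) : bool :=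
  if len x is Some a then a%:Z == l else false.

Lemma len_le_pull l m n (f : order_map m n) (x : vtuple V n) :
  len_le l x -> len_le l (pull f x).
Proof.
rewrite /len_le; case lx: (len x) => [a|] // le_al.
by have [b -> le_ba] := len_pull f lx; apply: le_trans le_al; rewrite lez_nat.
Qed.

Definition nerve_filt (l : int) : sub_sset nerve :=
  @SubSSet nerve (fun n x => len_le l (val x))
    (fun m n f x => @len_le_pull l m n f (val x)).

Lemma nerve_filt_le l l' n (x : nerve n) :
  l <= l' -> nerve_filt l n x -> nerve_filt l' n x.
Proof.
by rewrite /= /len_le; case: (len _) => // a le_l /le_trans; apply.
Qed.

Definition inj_word n (x : vtuple V n) : bool :=
  injectiveb x && [forall i : 'I_n.+1, forall j : 'I_n.+1,
                     (i < j)%N ==> connect E (x i) (x j)].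

Lemma inj_word_del n (i : 'I_n.+2) (x : vtuple V n.+1) :
  inj_word x -> inj_word (del i x).
Proof.
move=> /andP[/injectiveP x_inj /forallP xP]; apply/andP; split.
  by apply/injectiveP => j k; rewrite !ffunE => /x_inj/lift_inj.
apply/forallP => j; apply/forallP => k; apply/implyP => lt_jk; rewrite !ffunE.
have /forallP/(_ (lift i k))/implyP := xP (lift i j); apply.
by rewrite /= /bump; lia.
Qed.

Definition word n : finType := {x : vtuple V n | inj_word x}.

Definition word_del n (i : 'I_n.+2) (x : word n.+1) : word n :=
  Sub (del i (val x)) (inj_word_del i (valP x)).

Lemma word_delK n (i j : 'I_n.+2) (x : word n.+2) : (i <= j)%N ->
  word_del i (word_del (lift ord0 j) x) =
  word_del j (word_del (widen_ord (leqnSn n.+2) i) x).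
Proof. by move=> le_ij; apply: val_inj; apply: delK. Qed.

Definition inj_words : semi_sset := SemiSSet word_delK.

Section Homologies.
Variable R : comPzRingType.

Definition nerve_chains : filtered_complex R :=
  filtered_chains R full_nerve nerve_filt_le.

(* Filtered by F_l N^i = N^i :&: F_l N *)
Definition inj_nerve_chains : filtered_complex R :=
  filtered_chains R inj_nerve nerve_filt_le.

Section EulerianMagnitude.
Variable l : int.

Definition eulerian n : pred (tuple_sset V n) :=
  [pred x : vtuple V n | injectiveb x && len_is l x].

Definition inner n : pred 'I_n.+2 := [pred i : 'I_n.+2 | (0 < i < n.+1)%N].

Lemma innerK n (i j : 'I_n.+2) : (i <= j)%N ->
  inner i && inner (lift ord0 j) = inner j && inner (widen_ord (leqnSn n.+2) i).
Proof. by move=> le_ij; rewrite /inner /= /bump leq0n; lia. Qed.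

Lemma eulerian_bad n (x : vtuple V n.+2) (i : 'I_n.+3) (z : vtuple V n) :
  eulerian x -> inner i -> ~~ eulerian (del i x) -> eulerian z ->
  \sum_(j | inner j) (-1) ^+ j * (del j (del i x) == z)%:R = 0 :> R.
Proof.
move=> /andP[/injectiveP x_inj lx] _ ny /andP[_ lz].
apply: big1 => j _; case: eqP => [zE|]; last by rewrite mulr0.
case/negP: ny; rewrite /= /len_is; apply/andP; split.
  by apply/injectiveP => a b; rewrite !ffunE => /x_inj/lift_inj.
have delE m (a : 'I_m.+2) (u : vtuple V m.+1) : del a u = pull (coface a) u by [].
move: lx lz; rewrite /len_is -zE; case lx: (len x) => [a|] // /eqP al.
have [b ly le_ba] := len_pull (coface i) lx.
rewrite !delE ly; have [c -> le_cb] := len_pull (coface j) ly.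
by move=> /eqP cl; move: al cl; lia.
Qed.

Definition EMC : complex R :=
  @pchains R (tuple_sset V) eulerian inner innerK eulerian_bad.
End EulerianMagnitude.

Definition EMH (k : nat) (l : int) : lmodType R := Hn (EMC l) k.

Definition allowed n : pred (vtuple V n) :=
  [pred x : vtuple V n | [forall i : 'I_n, E (x (src i)) (x (tgt i))]].

Local Notation Lambda := (chains R (tuple_sset V)).

Definition A_iota n : submod (Lambda n) :=
  supported R [pred x : vtuple V n | injectiveb x && allowed x].

Lemma Omega_closed n :
  submod_closed [pred v | (v \in A_iota n) && (bnd Lambda n v \in A_iota n.-1)].
Proof.
split=> [|a x y /andP[Ax Adx] /andP[Ay Ady]]; apply/andP.
  by rewrite raddf0; split; apply: rpred0.
by rewrite linearP; split; apply: rpredD => //; apply: rpredZ.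
Qed.

Definition Omega_iota n : submod (Lambda n) := Submod (@Omega_closed n).

Lemma Omega_bnd n v : v \in Omega_iota n -> bnd Lambda n v \in Omega_iota n.-1.
Proof.
by move=> /andP[_ Av]; apply/andP; split=> //; rewrite bndK; apply: rpred0.
Qed.

Definition regular_path_complex : complex R := subcomplex Omega_bnd.

End Homologies.
End Digraph.

(* Main.v *)
(* A simplex of the injective nerve is a tuple of pairwise distinct vertices, so
   its k steps all have length at least 1 and its outer faces are strictly
   shorter than it is. Hence modulo F_(l-1) only the inner faces survive, which
   gives the eulerian magnitude complex; F_k vanishes above chain degree k, and
   in degree k it is spanned by the injective allowed tuples, so the diagonal of
   the second page is computed by the cycles of A_k modulo the boundaries of
   Omega_(k+1). In each chain degree the filtration is finite, and without it
   the normalized chains are those of the injective words. *)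
From HB Require Import structures.
From mathcomp Require Import all_boot all_order all_algebra.
From mathcomp Require Import boolp zify.
Require Import Defs.

Set Implicit Arguments.
Unset Strict Implicit.
Unset Printing Implicit Defensive.

Import Order.TTheory GRing.Theory Num.Theory.
Local Open Scope ring_scope.

(** * Isomorphisms of subquotients *)

Section Isomorphisms.
Variable R : comPzRingType.

Lemma lmod_iso_sym (M M' : lmodType R) : lmod_iso M M' -> lmod_iso M' M.
Proof.
move=> [f [g fK gK]].
have g_lin : linear g.
  by move=> a x y; apply: (can_inj fK); rewrite linearP !gK.
pose g' : {linear M' -> M} :=
  HB.pack g (GRing.isLinear.Build R M' M _ g g_lin).
by exists g', f.
Qed.

(** First isomorphism theorem. [T] need not lie in [S], so the kernel of [f] is compared with the
    trace of [T] on [S]. *)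
Lemma subquo_iso (M N : lmodType R) (S T : submod M)
    (f : {linear submod_type S -> N}) :
  (forall x, f x = 0 <-> submod_val x \in T) -> (forall y, exists x, f x = y) ->
  lmod_iso (subquo S T) N.
Proof.
move=> fT f_surj; have fT0 x : val x \in T -> f x = 0 by move/fT.
exists (subquo_lift fT0); apply: inj_surj_bij => [u v|y]; last first.
  by have [x <-] := f_surj y; exists (subquo_class S T x); rewrite subquo_liftE.
have [x ->] := subquo_classP u; have [y ->] := subquo_classP v.
rewrite !subquo_liftE => /eqP; rewrite -subr_eq0 -linearB => /eqP/fT Txy.
by apply/subquo_class_eqP; rewrite -linearB.
Qed.

(** The equality of memberships gives well-definedness and injectivity at once; surjectivity is only
    required modulo [T']. *)
Lemma subquo_map_iso (M M' : lmodType R) (S T : submod M) (S' T' : submod M')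
    (f : {linear M -> M'}) :
  (forall x, x \in S -> f x \in S') ->
  (forall x, x \in S -> (f x \in T') = (x \in T)) ->
  (forall y, y \in S' -> exists2 x, x \in S & f x - y \in T') ->
  lmod_iso (subquo S T) (subquo S' T').
Proof.
move=> fS fT f_surj.
apply: (@subquo_iso _ _ _ _ (submod_map_class T' fS)) => [x|y].
  rewrite -(fT _ (submod_valP x)).
  by split=> [/subquo_class0P|Tx]; [|apply/subquo_class0P].
have [[z Sz] ->] := subquo_classP y.
have [x Sx Txz] := f_surj z Sz; exists (SubmodType Sx).
exact/subquo_class_eqP.
Qed.

Section Corestriction.
Variables (M N : lmodType R) (S : submod N) (f : {linear M -> N}).
Hypothesis fS : forall x, f x \in S.

Definition corestrict_fun x : submod_type S := SubmodType (fS x).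

Lemma corestrict_linear : linear corestrict_fun.
Proof. by move=> a x y; apply: val_inj; rewrite /= linearP. Qed.

HB.instance Definition _ :=
  GRing.isLinear.Build R M (submod_type S) _ corestrict_fun corestrict_linear.

Definition corestrict : {linear M -> submod_type S} := corestrict_fun.
End Corestriction.

End Isomorphisms.

(** * Functoriality of the spectral sequence of a filtered complex *)

Section FilteredMaps.
Variables (R : comPzRingType) (C C' : filtered_complex R).
Variable f : forall k, {linear C k -> C' k}.
Hypothesis f_bnd : forall k x, f k.-1 (bnd C k x) = bnd C' k (f k x).
Hypothesis f_filt : forall l k x, x \in filt C l k -> f k x \in filt C' l k.

Lemma map_cycles l r k x : x \in cycles C l r k -> f k x \in cycles C' l r k.
Proof.
move=> /cyclesP[Fx Fdx]; apply/cyclesP; split; first exact: f_filt.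
by rewrite -f_bnd; apply: f_filt.
Qed.

Lemma map_boundaries l r k x : x \in cycles C l r k ->
  x \in boundaries C l r k -> f k x \in boundaries C' l r k.
Proof.
move=> _ /boundariesP[a][b][Za Zb ->]; apply/boundariesP.
by exists (f k a), (f k.+1 b); rewrite linearD (f_bnd b) !map_cycles.
Qed.

Definition page_map l r k : {linear fpage C l r k -> fpage C' l r k} :=
  subquo_map (@map_cycles l r%:Z k) (@map_boundaries l r%:Z k).

Lemma page_mapE l (r k : nat) x : page_map l r k (subquo_class _ _ x) =
  subquo_class _ _ (submod_map (@map_cycles l r%:Z k) x).
Proof. exact: subquo_mapE. Qed.

Lemma page_map_diff l l' r k (h : l' = l - r%:Z) x :
  page_map l' r k.-1 (fdiff C k h x) = fdiff C' k h (page_map l r k x).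
Proof.
have [y ->] := subquo_classP x; rewrite fdiffE !page_mapE fdiffE.
by congr (subquo_class _ _ _); apply: val_inj; apply: f_bnd.
Qed.

(** [fnext] keeps the underlying chain of a representative, so both sides are the class of the image
    under [f] of one and the same cycle. *)
Lemma page_map_next l r k x :
  fnext C' l r k (page_map l r.+1 k x) =
  homology_map (page_map_diff (esym (addrK r%:Z l)))
    (page_map_diff (erefl (l - r%:Z))) (fnext C l r k x).
Proof.
have [y ->] := subquo_classP x.
have fnextE D (z : submod_type (cycles D l r.+1%:Z k)) :
  fnext D l r k (subquo_class _ _ z) = fnext_pre z by apply: subquo_liftE.
rewrite page_mapE !fnextE [RHS]subquo_mapE.
congr (subquo_class _ _ _); apply: val_inj; apply/esym/(etrans (page_mapE _)).
by congr (subquo_class _ _ _); apply: val_inj.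
Qed.

Definition filtered_ss_hom :
  ss_hom (spectral_sequence C) (spectral_sequence C') :=
  @SSHom R (spectral_sequence C) (spectral_sequence C') page_map
    page_map_diff page_map_next.

End FilteredMaps.

(** * Convergence for a filtration that is finite in each degree *)

Section BoundedConvergence.
Variables (R : comPzRingType) (C : filtered_complex R) (H : nat -> lmodType R).
(** Together with [h_surj] and [hP], this presents [H k] as cycles modulo boundaries, so that the
    abutment may be the homology of another, isomorphic complex. *)
Variable h : forall k, {linear submod_type (ker (bnd C k)) -> H k}.
Hypothesis h_surj : forall k y, exists x, h k x = y.
Hypothesis hP : forall k x, h k x = 0 <-> submod_val x \in im (bnd C k.+1).
Hypothesis filt_low : forall k, exists a, forall x, x \in filt C a k -> x = 0.
Hypothesis filt_top : forall k, exists b, forall x, x \in filt C b k.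

Lemma filt_image_closed l k : submod_closed [pred y |
  `[< exists2 x, submod_val x \in filt C l k & h k x = y >]].
Proof.
split=> [|a _ _ /asboolP[x Fx <-] /asboolP[y Fy <-]]; apply/asboolP.
  by exists 0; rewrite ?raddf0 ?rpred0.
exists (a *: x + y); last by rewrite linearP.
by rewrite -[submod_val _]/(val _) linearP rpredD ?rpredZ.
Qed.

(** Serves as the filtration [Phi] of the abutment in [converges_to]. *)
Definition filt_image l k : submod (H k) := Submod (@filt_image_closed l k).

Lemma filt_imageP l k y :
  reflect (exists2 x, submod_val x \in filt C l k & h k x = y)
    (y \in filt_image l k).
Proof. exact: asboolP. Qed.

Section StablePage.
Variables (l : int) (r k : nat).
Hypothesis F0 : forall x, x \in filt C (l - r%:Z) k.-1 -> x = 0.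
Hypothesis FT : forall x, x \in filt C (l + r%:Z - 1) k.+1.

Lemma stable_cycle_ker (x : submod_type (cycles C l r%:Z k)) :
  submod_val x \in ker (bnd C k).
Proof. by apply/kerP; have /cyclesP[_ /F0] := submod_valP x. Qed.

Definition stable_class : {linear submod_type (cycles C l r%:Z k) -> H k} :=
  h k \o @corestrict R _ _ _ \val stable_cycle_ker.

Lemma stable_class_filt x : stable_class x \in filt_image l k.
Proof.
by apply/filt_imageP; eexists; [|reflexivity]; have /cyclesP[] := submod_valP x.
Qed.

(** By [F0] the page-r cycles are the true cycles in F_l. By [FT] the submodule divided out consists
    of the true cycles in F_(l-1) plus all true boundaries lying in F_l. The quotient is thus the
    graded piece of the homology. *)
Lemma stable_page_iso :
  lmod_iso (fpage C l r k) (subquo (filt_image l k) (filt_image (l - 1) k)).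
Proof.
pose f : {linear submod_type (cycles C l r%:Z k) ->
                 subquo (filt_image l k) (filt_image (l - 1) k)} :=
  subquo_class _ _ \o corestrict stable_class_filt.
apply: (@subquo_iso _ _ _ _ _ f) => [x|y].
  have /cyclesP[Fx /F0 dx0] := submod_valP x.
  split=> [/subquo_class0P/filt_imageP[z Fz /= hz]|/boundariesP[a][b][Za Zb xE]].
    have /imP[b db] : submod_val (SubmodType (stable_cycle_ker x) - z)
      \in im (bnd C k.+1) by apply/hP; rewrite linearB hz subrr.
    have /kerP dz0 := submod_valP z.
    have xE : submod_val x = submod_val z + bnd C k.+1 b.
      by rewrite db /= addrC subrK.
    apply/boundariesP; exists (submod_val z), b; split=> //; apply/cyclesP.
      by rewrite dz0 rpred0.
    split; first exact: FT.
    (* The index to reach, l + r - 1 - (r - 1), is l, and both [x] and [z] lie in F_l. *)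
    have -> : bnd C k.+1 b = submod_val x - submod_val z by rewrite xE addrC addKr.
    apply: rpredB; [apply: filt_le Fx | apply: filt_le Fz]; lia.
  apply/subquo_class0P/filt_imageP.
  have /cyclesP[Fa _] := Za.
  (* [a] differs from the true cycle [x] by a boundary. *)
  have da0 : a \in ker (bnd C k).
    apply/kerP; rewrite -dx0.
    transitivity (bnd C k (a + bnd C k.+1 b)); last by rewrite -xE.
    by rewrite linearD bndSK addr0.
  exists (SubmodType da0) => //.
  apply/eqP; rewrite -subr_eq0 -linearB; apply/eqP/hP.
  by apply/imP; exists (- b); rewrite linearN /= xE opprD addNKr.
have [[z Fz] ->] := subquo_classP y; have /filt_imageP[x Fx hx] := Fz.
have Zx : submod_val x \in cycles C l r%:Z k.
  by apply/cyclesP; have /kerP -> := submod_valP x; rewrite rpred0.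
exists (SubmodType Zx); congr (subquo_class _ _ _); apply: val_inj => /=.
by rewrite -hx; congr (h k _); apply: val_inj.
Qed.

Lemma stable_diff_out (x : fpage C l r k) : fdiff C k (erefl (l - r%:Z)) x = 0.
Proof.
have [y ->] := subquo_classP x; rewrite fdiffE; apply/subquo_class0P.
by have /cyclesP[_ /F0 dy] := submod_valP y; rewrite [val _]dy rpred0.
Qed.

(** By [FT] a representative from F_(l+r) already lies in F_(l+r-1), so its boundary is among those
    divided out on page r. *)
Lemma stable_diff_in (x : fpage C (l + r%:Z) r k.+1) :
  fdiff C k.+1 (esym (addrK r%:Z l)) x = 0.
Proof.
have [y ->] := subquo_classP x; rewrite fdiffE; apply/subquo_class0P => /=.
apply/boundariesP; exists 0, (submod_val y); rewrite rpred0 add0r; split=> //.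
apply/cyclesP; split; first exact: FT.
by have /cyclesP[_] := submod_valP y; apply: filt_le; lia.
Qed.

End StablePage.

Lemma bounded_converges : converges_to (spectral_sequence C) H.
Proof.
exists filt_image; split=> [l l' k x le_l /filt_imageP[y Fy yx]|k|l k].
- by apply/filt_imageP; exists y => //; apply: filt_le Fy.
- have [a Fa] := filt_low k; have [b Fb] := filt_top k; exists a, b; split=> x.
    by move=> /filt_imageP[y /Fa y0 <-]; apply/hP/imP; exists 0; rewrite raddf0 y0.
  by have [z zx] := h_surj x; apply/filt_imageP; exists z.
have [a Fa] := filt_low k.-1; have [b Fb] := filt_top k.+1.
(* The first summand forces l - r <= a, the second b <= l + r - 1. *)
exists (absz (l - a)%R + absz (b + 1 - l)%R)%N => r le_r.
have F0 x : x \in filt C (l - r%:Z) k.-1 -> x = 0.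
  by move=> Fx; apply: Fa; apply: filt_le Fx; lia.
have FT x : x \in filt C (l + r%:Z - 1) k.+1.
  by apply: filt_le (Fb x); lia.
split; [exact: stable_diff_out | exact: stable_diff_in | exact: stable_page_iso].
Qed.

End BoundedConvergence.

(** * Boundaries and projections in coefficients *)

Section Coefficients.
Variable R : comPzRingType.

Lemma extend_coef (T T' : finType) (f : T -> free R T') (c : free R T) z :
  extend f c z = \sum_x c x * f x z :> R.
Proof. by rewrite sum_ffunE; apply: eq_bigr => x _; rewrite ffunE. Qed.

(** Used to compare boundary coefficients in two complexes whose bases are related by an
    injection. *)
Lemma sum_inj (T T' : finType) (s : T' -> T) (F : T -> R) (F' : T' -> R) :
  injective s -> (forall z, F (s z) = F' z) ->
  (forall x, (forall z, s z != x) -> F x = 0) -> \sum_x F x = \sum_z F' z.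
Proof.
move=> s_inj Fs F0; rewrite (bigID (fun x => x \in codom s)) /=.
rewrite addrC big1 ?add0r => [|x /codomP nx]; last first.
  by apply: F0 => z; apply/eqP => zx; apply: nx; exists z.
rewrite -big_uniq /=; last exact/injectiveP.
by rewrite /codom /image_mem big_map big_enum; apply: eq_bigr.
Qed.

Section Restrict.
Variables (T T' : finType) (s : T' -> T).

(** For injective [s] this is the projection sending [gen (s z)] to [gen z] and every generator
    outside the image of [s] to 0. The comparison maps between complexes below all have this
    form. *)
Definition restrict_fun (c : free R T) : free R T' := [ffun z => c (s z)].

Lemma restrict_linear : linear restrict_fun.
Proof. by move=> a b c; apply/ffunP => z; rewrite !ffunE. Qed.

HB.instance Definition _ :=
  GRing.isLinear.Build R (free R T) (free R T') _ restrict_fun restrict_linear.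

Definition restrict : {linear free R T -> free R T'} := restrict_fun.

Lemma restrictE c z : restrict c z = c (s z) :> R.
Proof. by rewrite [LHS]ffunE. Qed.

Lemma restrict_onto (P : pred T) (b : free R T') : injective s ->
  (forall z, b z != 0 -> P (s z)) ->
  exists2 c, c \in supported R P & restrict c = b.
Proof.
move=> s_inj bP; exists (extend (fun z => gen R (s z)) b).
  apply: (@extend_supported _ _ _ (fun z => P (s z))); last exact/supportedP.
  by move=> z; apply: supported_gen.
apply/ffunP => z; rewrite restrictE extend_coef (bigD1 z) //= ffunE eqxx.
rewrite big1 ?addr0 ?mulr1 // => y /negPf yz.
by rewrite ffunE (inj_eq s_inj) eq_sym yz mulr0.
Qed.

Lemma restrict_eq0 (P : pred T) (c : free R T) : c \in supported R P ->
  (forall x, P x -> exists z, s z = x) -> restrict c = 0 -> c = 0.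
Proof.
move=> /supportedP Pc Ps c0; apply/ffunP => x; rewrite ffunE.
apply/eqP; apply: contraT => cx; have [z zx] := Ps x (Pc x cx).
by move/ffunP/(_ z): c0; rewrite restrictE zx ffunE => cx0; rewrite cx0 eqxx in cx.
Qed.

End Restrict.

(** Dropping the faces outside [P] is invisible in the coefficient at [z]: a face equal to [val z]
    lies in [P] because [z] does. *)
Lemma pchain_coef (X : semi_sset) (P : forall n, pred (X n))
    (sel : forall n, pred 'I_n.+2) n (c : pchain_mod R P n.+1) z :
  pchain_bnd R P sel n.+1 c z =
  \sum_x c x * \sum_(i | sel n i) (-1) ^+ i * (sface i (val x) == val z)%:R :> R.
Proof.
rewrite extend_coef; apply: eq_bigr => x _; congr (_ * _).
rewrite sum_ffunE; apply: eq_bigr => i _; rewrite ffunE ogenE.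
congr (_ * _%:R); congr nat_of_bool; case: insubP => [u _ <-|nP].
  exact: inj_eq Some_inj _ _.
by apply/esym/negbTE; apply: contraNneq nP => ->; apply: valP.
Qed.

Lemma chain_coef (X : semi_sset) n (c : free R (X n.+1)) z :
  chain_bnd R X n.+1 c z =
  \sum_x c x * \sum_(i < n.+2) (-1) ^+ i * (sface i x == z)%:R :> R.
Proof.
rewrite extend_coef; apply: eq_bigr => x _; congr (_ * _).
rewrite sum_ffunE; apply: eq_bigr => i _; rewrite !ffunE.
by rewrite [z == _]eq_sym.
Qed.

End Coefficients.

(** * Lengths of injective tuples and of their faces *)

Section Lengths.
Variables (V : finType) (E : rel V).

Lemma dist_connect x y : (dist E x y != None) = connect E x y.
Proof.
apply/idP/idP => [|/connect_walk[n /dist_le[c ->]] //].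
by case xy: (dist E x y) => [c|] // _; apply: walk_connect (dist_walk xy).
Qed.

Lemma dist_steps_reach n (x : vtuple V n) : dist_steps E x = reach_steps E x.
Proof. by apply: eq_forallb => i; apply: dist_connect. Qed.

Lemma len_reach n (x : vtuple V n) a : len E x = Some a -> reach_steps E x.
Proof. by rewrite /len dist_steps_reach; case: ifP. Qed.

(** Reachability is transitive, so consecutive letters suffice. *)
Lemma inj_wordE n (x : vtuple V n) :
  inj_word E x = injectiveb x && reach_steps E x.
Proof.
congr (_ && _); apply/forallP/idP => [xP|xP i].
  apply/forallP => i; have /forallP/(_ (tgt i))/implyP := xP (src i); apply.
  by rewrite /= /bump; lia.
by apply/forallP => j; apply/implyP => /ltnW; apply: reach_connect.
Qed.

(** Distance 0 means a walk without edges, which would make two entries equal. *)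
Lemma step_dist_gt0 n (x : vtuple V n) (i : 'I_n) :
  injective x -> reach_steps E x ->
  exists2 c, dist E (x (src i)) (x (tgt i)) = Some c & (0 < c)%N.
Proof.
rewrite -dist_steps_reach => x_inj /forallP/(_ i).
case xi: (dist E _ _) => [[|c]|] // _; last by exists c.+1.
have /walkP[p [/size0nil -> _ /= /x_inj/(congr1 val)]] := dist_walk xi.
by rewrite /= /bump; lia.
Qed.

Lemma len_ge n (x : vtuple V n) a : injective x -> len E x = Some a -> (n <= a)%N.
Proof.
move=> x_inj lx; have xP := len_reach lx.
move: lx; rewrite /len dist_steps_reach xP => -[<-].
rewrite -[leqLHS]muln1 -[X in (X * 1)%N]card_ord -sum_nat_const.
by apply: leq_sum => i _; have [c ->] := step_dist_gt0 i x_inj xP.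
Qed.

(** The n steps each have length at least 1, so a total of at most n makes every step a single
    edge. *)
Lemma len_le_allowed n (x : vtuple V n) :
  injective x -> len_le E n x = allowed E x.
Proof.
move=> x_inj; apply/idP/forallP => [|xE].
  rewrite /len_le; case lx: (len E x) => [a|] // le_an i.
  have xP := len_reach lx.
  move: lx; rewrite /len dist_steps_reach xP => -[aE].
  have [c xi c_gt0] := step_dist_gt0 i x_inj xP.
  (* The other n - 1 steps already contribute at least n - 1. *)
  have le_c1 : (c <= 1)%N.
    have : (c + n.-1 <= n)%N.
      apply: leq_trans (_ : a <= n)%N; last by rewrite -lez_nat.
      rewrite -aE (bigD1 i) //= xi leq_add2l.
      have -> : n.-1 = (\sum_(j < n | j != i) 1)%N.
        by rewrite sum1_card cardC1 card_ord.
      by apply: leq_sum => j _; have [d ->] := step_dist_gt0 j x_inj xP.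
    by have := ltn_ord i; lia.
  have {c_gt0 le_c1} c1 : c = 1%N by lia.
  have /walkP[p [sp]] := dist_walk xi; rewrite c1 in sp.
  by case: p sp => [|y [|? ?]] //= _ /andP[xy _] <-.
have step i : exists2 c, dist E (x (src i)) (x (tgt i)) = Some c & (c <= 1)%N.
  by apply: dist_le; apply/walkP; exists [:: x (tgt i)]; rewrite /= xE.
have xP : dist_steps E x by apply/forallP => i; have [c ->] := step i.
rewrite /len_le /len xP lez_nat.
rewrite -[leqRHS]muln1 -[X in (X * 1)%N]card_ord -sum_nat_const.
by apply: leq_sum => i _; have [c ->] := step i.
Qed.

Lemma len_del_le n (x : vtuple V n.+1) (i : 'I_n.+2) a : len E x = Some a ->
  exists2 b, len E (del i x) = Some b & (b <= a)%N.
Proof. exact: (len_pull (coface i)). Qed.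

(** Deleting an end vertex removes one step of positive length and leaves the other steps as they
    are. *)
Lemma len_del_outer n (x : vtuple V n.+1) (i : 'I_n.+2) a :
  injective x -> len E x = Some a -> ~~ inner i ->
  exists2 b, len E (del i x) = Some b & (b < a)%N.
Proof.
move=> x_inj lx out_i; have xP := len_reach lx.
have [b lb _] := len_del_le i lx; exists b => //.
move: lb lx; rewrite /len !dist_steps_reach xP; case: ifP => // _ [<-] [<-].
have /orP[/eqP i0|/eqP in1] : (i == ord0) || (i == ord_max).
  by move: out_i; rewrite /inner /= -!val_eqE /=; have := ltn_ord i; lia.
  have [c xi c_gt0] := step_dist_gt0 ord0 x_inj xP.
  rewrite [ltnRHS]big_ord_recl xi /= -add1n leq_add // eq_leq //.
  apply: eq_bigr => j _; rewrite !ffunE i0.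
  by congr (odflt _ (dist _ (x _) (x _))); apply: val_inj.
have [c xi c_gt0] := step_dist_gt0 ord_max x_inj xP.
rewrite [ltnRHS]big_ord_recr xi /= -addn1 leq_add // eq_leq //.
apply: eq_bigr => j _; rewrite !ffunE in1.
by congr (odflt _ (dist _ (x _) (x _))); apply: val_inj; rewrite /= /bump;
  have := ltn_ord j; lia.
Qed.

End Lengths.

(** * Normalized chains of the injective nerve and their filtration *)

Section InjectiveNerve.
Variables (R : comPzRingType) (V : finType) (E : rel V).

Definition inj_simplex n : finType :=
  {x : semi_of_sset (nerve E) n | nondegenerate_in (inj_nerve E) x}.

Definition vertices n (x : inj_simplex n) : vtuple V n := val (val x).

Lemma vertices_inj n : injective (@vertices n).
Proof. exact: inj_comp val_inj val_inj. Qed.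

Lemma verticesP n (x : inj_simplex n) :
  injective (vertices x) /\ reach_steps E (vertices x).
Proof.
split; last exact: valP (val x).
by apply/injectiveP; rewrite -[injectiveb _]nondegenerate_inj_nerve; apply: valP.
Qed.

Lemma vertices_onto n (v : vtuple V n) :
  injective v -> reach_steps E v -> exists x, vertices x = v.
Proof.
move=> v_inj vP; pose y : nerve E n := Sub v vP.
have yP : nondegenerate_in (inj_nerve E) y.
  by rewrite nondegenerate_inj_nerve; apply/injectiveP.
by exists (Sub y yP).
Qed.

Lemma inj_nerve_coef n (c : inj_nerve_chains E R n.+1) z :
  bnd (inj_nerve_chains E R) n.+1 c z =
  \sum_x c x * \sum_(i < n.+2) (-1) ^+ i * (del i (vertices x) == vertices z)%:R
    :> R.
Proof. exact: pchain_coef. Qed.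

Lemma inj_nerve_filtP l n (c : inj_nerve_chains E R n) :
  reflect (forall x, c x != 0 -> len_le E l (vertices x))
    (c \in filt (inj_nerve_chains E R) l n).
Proof. exact: supportedP. Qed.

Lemma inj_nerve_filt_low l n (c : inj_nerve_chains E R n) :
  l < n%:Z -> c \in filt (inj_nerve_chains E R) l n -> c = 0.
Proof.
move=> lt_ln /inj_nerve_filtP cP; apply/ffunP => x; rewrite [RHS]ffunE.
apply/eqP; apply: contraT => /cP; rewrite /len_le.
case lx: (len E _) => [a|] // le_al; have [x_inj _] := verticesP x.
by have := len_ge x_inj lx; lia.
Qed.

Lemma inj_nerve_filt_top n :
  exists b, forall c, c \in filt (inj_nerve_chains E R) b n.
Proof.
(* The graph being finite, there are finitely many simplices in degree n. The default 0 never
   occurs, since simplices of the nerve have finite length. *)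
exists (\max_(x : inj_simplex n) odflt 0 (len E (vertices x)))%N => c.
apply/inj_nerve_filtP => x _; have [_ xP] := verticesP x.
rewrite /len_le; case lx: (len E _) => [a|].
  rewrite lez_nat; have -> : a = odflt 0%N (len E (vertices x)) by rewrite lx.
  exact: leq_bigmax.
by move: lx; rewrite /len dist_steps_reach xP.
Qed.

End InjectiveNerve.

(** * The inclusion of normalized chains *)

Section NormalizedInclusion.
Variables (X : sset) (R : comPzRingType) (S S' : sub_sset X).
Hypothesis SS' : forall n x, S n x -> S' n x.

(** Degeneracy is a property of [y] in [X], independent of [S] and [S'], so [y] is a generator of
    both complexes or counts as 0 in both. *)
Lemma normalized_incl_ogen n (y : X n) : S n y ->
  normalized_incl R S S' n (ogen R (insub y)) = ogen R (insub y).
Proof.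
move=> Sy; case: insubP => [u _ uy|nP]; first by rewrite /= [LHS]extendE uy.
rewrite raddf0 insubF //; apply: contraNF nP => /andP[_ ny].
exact/andP.
Qed.

Lemma normalized_incl_bnd n c :
  normalized_incl R S S' n.-1 (bnd (normalized_chains R S) n c) =
  bnd (normalized_chains R S') n (normalized_incl R S S' n c).
Proof.
case: n c => [|n] c; first by rewrite !bnd0 raddf0.
pose f : {linear normalized_chains R S n.+1 -> normalized_chains R S' n} :=
  normalized_incl R S S' n \o bnd (normalized_chains R S) n.+1.
pose g : {linear normalized_chains R S n.+1 -> normalized_chains R S' n} :=
  bnd (normalized_chains R S') n.+1 \o normalized_incl R S S' n.+1.
apply: (@free_ext R _ _ f g) => {c} x; rewrite /f /g /=.
rewrite [extend _ (gen _ x)]extendE [X in _ = extend _ X]extendE.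
have /andP[Sx nx] := valP x.
have S'x : nondegenerate_in S' (val x) by apply/andP; split; first exact: SS'.
rewrite (insubT (@nondegenerate_in X S' n.+1) S'x) /= extendE linear_sum.
apply: eq_bigr => i _; rewrite linearZ /=; congr (_ *: _).
by apply: normalized_incl_ogen; apply: sub_sset_act.
Qed.

Variable F : int -> sub_sset X.
Hypothesis F_le : forall l l' n (x : X n), l <= l' -> F l n x -> F l' n x.

Lemma normalized_incl_filt l n c :
  c \in filt (filtered_chains R S F_le) l n ->
  normalized_incl R S S' n c \in filt (filtered_chains R S' F_le) l n.
Proof.
apply: extend_supported => x Fx; case: insubP => [u _ ux|_]; last exact: rpred0.
by apply: supported_gen; rewrite /= ux.
Qed.

End NormalizedInclusion.

Section Pages.
Variables (R : comPzRingType) (V : finType) (E : rel V).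
Local Notation C := (inj_nerve_chains E R).
Local Notation Lambda := (chains R (tuple_sset V)).

(** * The first page and eulerian magnitude homology *)

Section FirstPage.
Variable l : int.
Local Notation tuples n := {x : tuple_sset V n | eulerian E l x}.

Lemma eulerian_simplex_exists n (x : tuples n) :
  exists y : inj_simplex E n, vertices y = val x.
Proof.
have /andP[/injectiveP x_inj] := valP x.
rewrite /len_is; case lx: (len E _) => [a|] // _.
by apply: vertices_onto => //; apply: len_reach lx.
Qed.

Definition eulerian_simplex n (x : tuples n) : inj_simplex E n :=
  sval (cid (eulerian_simplex_exists x)).

Lemma eulerian_simplexE n (x : tuples n) : vertices (eulerian_simplex x) = val x.
Proof. by rewrite /eulerian_simplex; case: cid. Qed.

Lemma eulerian_simplex_inj n : injective (@eulerian_simplex n).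
Proof.
move=> x y /(congr1 (@vertices V E n)); rewrite !eulerian_simplexE.
exact: val_inj.
Qed.

Lemma eulerian_simplexP n (x : inj_simplex E n) :
  len_is E l (vertices x) -> exists y, eulerian_simplex y = x.
Proof.
move=> lx; have [/injectiveP x_inj _] := verticesP x.
have xP : eulerian E l (vertices x : tuple_sset V n) by apply/andP.
exists (Sub (vertices x : tuple_sset V n) xP); apply: vertices_inj.
by rewrite eulerian_simplexE.
Qed.

Lemma len_leE n (x : vtuple V n) :
  len_le E l x = len_is E l x || len_le E (l - 1) x.
Proof.
by rewrite /len_le /len_is; case: len => // a; apply/idP/orP; lia.
Qed.

(** On F_l this is the quotient map to F_l / F_(l-1), identified with the eulerian complex; it is
    used as a chain map on F_l only. *)
Definition leading_part n : {linear C n -> EMC E R l n} :=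
  restrict R (@eulerian_simplex n).

Lemma leading_part_eq0 n (c : C n) : c \in filt C l n ->
  leading_part n c = 0 <-> c \in filt C (l - 1) n.
Proof.
move=> /inj_nerve_filtP cP; split=> [c0|/inj_nerve_filtP Fc].
  apply/inj_nerve_filtP => x cx; have := cP x cx.
  rewrite len_leE => /orP[/eulerian_simplexP[y yx]|//].
  move/ffunP/(_ y): c0; rewrite restrictE yx ffunE => cx0.
  by rewrite cx0 eqxx in cx.
apply/ffunP => y; rewrite restrictE [RHS]ffunE; apply/eqP.
apply: contraT => /Fc; rewrite eulerian_simplexE; have /andP[_] := valP y.
by rewrite /len_is /len_le; case: len => // a; lia.
Qed.

(** Outer faces of a simplex of length l, and all faces of shorter simplices, have length below l.
    They cannot equal a tuple of length l, which leaves the inner faces. *)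
Lemma leading_part_bnd n (c : C n) : c \in filt C l n ->
  leading_part n.-1 (bnd C n c) = bnd (EMC E R l) n (leading_part n c).
Proof.
case: n c => [|n] c; first by rewrite !bnd0 raddf0.
move=> /inj_nerve_filtP cP; apply/ffunP => z.
rewrite restrictE inj_nerve_coef [RHS]pchain_coef.
have lz : len_is E l (val z) by have /andP[] := valP z.
have zF b (v : vtuple V n) : len E v = Some b -> b%:Z < l -> (v == val z) = false.
  move=> lv lt_bl; apply/eqP => vz; move: lz; rewrite -vz /len_is lv.
  by lia.
apply: (sum_inj (@eulerian_simplex_inj n.+1)) => [x|x nx].
  rewrite restrictE !eulerian_simplexE; congr (_ * _).
  rewrite [RHS]big_mkcond; apply: eq_bigr => i _; case: ifP => // /negbT out_i.
  have /andP[/injectiveP x_inj] := valP x; rewrite /len_is.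
  case lx: (len E _) => [a|] // /eqP al.
  have [b lb lt_ba] := len_del_outer x_inj lx out_i.
  by rewrite (zF _ _ lb) ?mulr0 // -al.
have [->|/cP lx] := eqVneq (c x) 0; first by rewrite mul0r.
rewrite big1 ?mulr0 // => i _; rewrite eulerian_simplexE.
have {lx}[a lx lt_al] : exists2 a, len E (vertices x) = Some a & a%:Z < l.
  move: lx; rewrite len_leE => /orP[/eulerian_simplexP[y /eqP]|].
    by rewrite (negPf (nx y)).
  by rewrite /len_le; case: len => // a le_a; exists a => //; lia.
have [b lb le_ba] := len_del_le i lx.
by rewrite (zF _ _ lb) ?mulr0 //; lia.
Qed.

Lemma leading_part_onto n (y : EMC E R l n) :
  exists2 c, c \in filt C l n & leading_part n c = y.
Proof.
apply: (restrict_onto (@eulerian_simplex_inj n)) => z _.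
rewrite /= -[val (val _)]/(vertices _) eulerian_simplexE len_leE.
by have /andP[_ ->] := valP z.
Qed.

Lemma first_page_iso k : lmod_iso (fpage C l 1 k) (EMH E R k l).
Proof.
apply: (@subquo_map_iso _ _ _ _ _ _ _ (leading_part k)) => [x|x|y].
- move=> /cyclesP[Fx Fdx]; apply/kerP; rewrite -leading_part_bnd //.
  by apply/leading_part_eq0; [apply: filt_bnd|].
- move=> /cyclesP[Fx Fdx]; apply/imP/boundariesP => [[y yx]|[a][b][]].
    have [b Fb bq] := leading_part_onto y.
    (* [b] lifts [y] to F_l, so subtracting its boundary kills the leading part of [x] and leaves an
       element of F_(l-1). *)
    exists (x - bnd C k.+1 b), b; rewrite subrK; split=> //.
      have Fa : x - bnd C k.+1 b \in filt C (l - 1) k.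
        apply/leading_part_eq0; first by rewrite rpredB // (filt_bnd Fb).
        by rewrite linearB (leading_part_bnd Fb) bq yx subrr.
      by apply/cyclesP; rewrite !subrr subr0; split=> //; apply: filt_bnd.
    apply/cyclesP; rewrite addrK subrr subr0; split=> //.
    exact: (filt_bnd Fb).
  move=> /cyclesP[Fa _] /cyclesP[]; rewrite addrK => Fb _ ->.
  exists (leading_part k.+1 b); rewrite linearD -(leading_part_bnd Fb).
  have Fla : a \in filt C l k by apply: filt_le Fa; lia.
  by rewrite ((leading_part_eq0 Fla).2 Fa) add0r.
move=> /kerP dy; have [x Fx xy] := leading_part_onto y; exists x.
  apply/cyclesP; split=> //; apply/leading_part_eq0; first exact: filt_bnd.
  by rewrite leading_part_bnd // xy.
by rewrite xy subrr rpred0.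
Qed.

End FirstPage.

(** * The diagonal of the second page and regular path homology *)

Section SecondPage.

Definition simplex_part n : {linear Lambda n -> C n} :=
  restrict R (@vertices V E n).

(** The boundary of an allowed chain need not be allowed, but it stays in the span of these tuples,
    where [simplex_part] is injective and commutes with boundaries. *)
Definition reach_injective n : pred (vtuple V n) :=
  [pred x : vtuple V n | injectiveb x && reach_steps E x].

Lemma allowed_reach n (x : vtuple V n) : allowed E x -> reach_steps E x.
Proof. by move=> /forallP xP; apply/forallP => i; apply: connect1. Qed.

Lemma A_iota_reach n v :
  v \in A_iota E R n -> v \in supported R (@reach_injective n).
Proof.
move=> /supportedP vP; apply/supportedP => x /vP /andP[x_inj /allowed_reach xE].
exact/andP.
Qed.

Lemma bnd_reach n v : v \in supported R (@reach_injective n) ->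
  bnd Lambda n v \in supported R (@reach_injective n.-1).
Proof.
case: n v => [|n] v; first by rewrite rpred0.
apply: extend_supported => x /andP[/injectiveP x_inj xP].
apply: rpred_sum => i _; apply/rpredZ/supported_gen/andP; split.
  by apply/injectiveP => a b; rewrite !ffunE => /x_inj/lift_inj.
exact: (reach_pull (coface i) xP).
Qed.

Lemma reach_vertices n (x : vtuple V n) :
  reach_injective x -> exists y : inj_simplex E n, vertices y = x.
Proof. by move=> /andP[/injectiveP]; apply: vertices_onto. Qed.

Lemma simplex_part_eq0 n v : v \in supported R (@reach_injective n) ->
  simplex_part n v = 0 -> v = 0.
Proof. by move=> vP; apply: restrict_eq0 vP (@reach_vertices n). Qed.

Lemma simplex_part_bnd n v : v \in supported R (@reach_injective n) ->
  simplex_part n.-1 (bnd Lambda n v) = bnd C n (simplex_part n v).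
Proof.
case: n v => [|n] v; first by rewrite !bnd0 raddf0.
move=> /supportedP vP; apply/ffunP => z.
rewrite restrictE [LHS]chain_coef inj_nerve_coef.
apply: (sum_inj (@vertices_inj V E n.+1)) => [x|x nx].
  by rewrite restrictE.
have [->|/vP/reach_vertices[y /eqP]] := eqVneq (v x) 0; first by rewrite mul0r.
by rewrite (negPf (nx y)).
Qed.

(** By [len_le_allowed], F_n in degree n is the span of the allowed tuples. *)
Lemma simplex_part_filt (n : nat) v : v \in supported R (@reach_injective n) ->
  (simplex_part n v \in filt C n%:Z n) = (v \in A_iota E R n).
Proof.
move=> /supportedP vP; apply/inj_nerve_filtP/supportedP => [Fv x vx|Av x].
  have [y yx] := reach_vertices (vP x vx); have [x_inj _] := verticesP y.
  have : len_le E n (vertices y) by apply: Fv; rewrite restrictE yx.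
  rewrite len_le_allowed // yx => xE; apply/andP; split=> //.
  by apply/injectiveP; rewrite -yx.
rewrite restrictE => /Av/andP[/injectiveP x_inj xE].
by rewrite len_le_allowed.
Qed.

Lemma simplex_part_onto (n : nat) c : c \in filt C n%:Z n ->
  exists2 v, v \in A_iota E R n & simplex_part n v = c.
Proof.
move=> /inj_nerve_filtP cP; apply: (restrict_onto (@vertices_inj V E n)) => z.
move=> /cP; have [z_inj _] := verticesP z; rewrite len_le_allowed // => zE.
by apply/andP; split=> //; apply/injectiveP.
Qed.

Lemma second_page_iso (k : nat) :
  lmod_iso (fpage C k%:Z 2 k) (Hn (regular_path_complex E R) k).
Proof.
(* These chains correspond to Omega_(k+1): F_(k+1) in degree k + 1 means allowed, and F_k in degree
   k means that the boundary is allowed. *)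
have cyclesE b : b \in cycles C (k%:Z + 2%:Z - 1) (2%:Z - 1) k.+1 =
    (b \in filt C k.+1%:Z k.+1) && (bnd C k.+1 b \in filt C k%:Z k).
  have <- : k%:Z + 2%:Z - 1 = k.+1%:Z by lia.
  have e : k%:Z + 2%:Z - 1 - (2%:Z - 1) = k%:Z by lia.
  by apply/cyclesP/andP; rewrite e.
(* The comparison map reads coefficients of path chains, hence starts at the path homology. *)
apply: lmod_iso_sym.
pose f : {linear submod_type (Omega_iota E R k) -> C k} :=
  simplex_part k \o \val.
have OmegaP n (v : submod_type (Omega_iota E R n)) :
    submod_val v \in A_iota E R n.
  by have /andP[] := submod_valP v.
apply: (@subquo_map_iso _ _ _ _ _ _ _ f) => [v|v|c].
- move=> /kerP dv0.
  have dv : bnd Lambda k (submod_val v) = 0 := congr1 (@submod_val _ _ _) dv0.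
  have Av := A_iota_reach (OmegaP _ v).
  apply/cyclesP; rewrite simplex_part_filt // OmegaP; split=> //.
  by rewrite -simplex_part_bnd // dv raddf0 rpred0.
- move=> /kerP dv; have Av := A_iota_reach (OmegaP _ v).
  apply/boundariesP/imP => [[a][b][]|[w <-]]; last first.
    have Aw := A_iota_reach (OmegaP _ w).
    exists 0, (simplex_part k.+1 (submod_val w)); rewrite rpred0 add0r; split=> //.
      rewrite cyclesE simplex_part_filt // OmegaP -simplex_part_bnd //=.
      rewrite simplex_part_filt; first by have /andP[] := submod_valP w.
      exact: (bnd_reach Aw).
    by rewrite -(simplex_part_bnd Aw).
  move=> /cyclesP[/inj_nerve_filt_low a0 _]; rewrite cyclesE.
  move=> /andP[/simplex_part_onto[w Aw <-] Fdw vE]; have Rw := A_iota_reach Aw.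
  have Ow : w \in Omega_iota E R k.+1.
    apply/andP; split=> //.
    by rewrite -(simplex_part_filt (bnd_reach Rw)) (simplex_part_bnd Rw).
  exists (SubmodType Ow); apply: val_inj; apply/eqP; rewrite -subr_eq0; apply/eqP.
  apply: simplex_part_eq0; first by rewrite rpredB // (bnd_reach Rw).
  (* The summand [a] lies in F_(k-1) in degree k, which is 0. *)
  rewrite linearB /= [simplex_part k (submod_val v)]vE a0 ?add0r; last by lia.
  by rewrite (simplex_part_bnd Rw) subrr.
move=> /cyclesP[/simplex_part_onto[v Av <-]].
have Rv := A_iota_reach Av; rewrite -simplex_part_bnd //.
(* The boundary lies in F_(k-2) in degree [k.-1], hence vanishes, also for k = 0. *)
move=> /inj_nerve_filt_low d0.
have dv : bnd Lambda k v = 0.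
  by apply: simplex_part_eq0 (bnd_reach Rv) (d0 _); lia.
have Ov : v \in Omega_iota E R k by apply/andP; split; rewrite // dv rpred0.
exists (SubmodType Ov); first by apply/kerP; apply: val_inj.
by rewrite [f _]/(simplex_part k v) subrr rpred0.
Qed.

End SecondPage.

(** * Convergence to the homology of injective words *)

Section Abutment.

Lemma word_simplex_exists n (x : word E n) :
  exists y : inj_simplex E n, vertices y = val x.
Proof.
have := valP x; rewrite inj_wordE => /andP[/injectiveP x_inj xP].
exact: vertices_onto.
Qed.

Definition word_simplex n (x : word E n) : inj_simplex E n :=
  sval (cid (word_simplex_exists x)).

Lemma word_simplexE n (x : word E n) : vertices (word_simplex x) = val x.
Proof. by rewrite /word_simplex; case: cid. Qed.

Lemma word_simplex_inj n : injective (@word_simplex n).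
Proof.
move=> x y /(congr1 (@vertices V E n)); rewrite !word_simplexE.
exact: val_inj.
Qed.

Lemma word_simplex_onto n (x : inj_simplex E n) : exists y, word_simplex y = x.
Proof.
have [/injectiveP x_inj xP] := verticesP x.
have wx : inj_word E (vertices x) by rewrite inj_wordE x_inj.
by exists (Sub (vertices x) wx); apply: vertices_inj; rewrite word_simplexE.
Qed.

Local Notation W := (chains R (inj_words E)).

Definition word_chain n : {linear C n -> W n} := restrict R (@word_simplex n).

Lemma word_chain_bnd n c :
  word_chain n.-1 (bnd C n c) = bnd W n (word_chain n c).
Proof.
case: n c => [|n] c; first by rewrite !bnd0 raddf0.
apply/ffunP => z; rewrite restrictE inj_nerve_coef [RHS]chain_coef.
apply: (sum_inj (@word_simplex_inj n.+1)) => [x|x nx].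
  by rewrite restrictE !word_simplexE.
by have [y /eqP] := word_simplex_onto x; rewrite (negPf (nx y)).
Qed.

Lemma word_chain_onto n w : exists c, word_chain n c = w.
Proof.
by have [|c _] := @restrict_onto R _ _ _ xpredT w (@word_simplex_inj n);
  [|exists c].
Qed.

Lemma word_chain_eq0 n c : word_chain n c = 0 -> c = 0.
Proof.
apply: (@restrict_eq0 R _ _ _ xpredT); first exact/supportedP.
by move=> x _; apply: word_simplex_onto.
Qed.

Lemma word_chain_ker k x : x \in ker (bnd C k) -> word_chain k x \in ker (bnd W k).
Proof. by move=> /kerP dx; apply/kerP; rewrite -word_chain_bnd dx raddf0. Qed.

(** [word_chain] is an isomorphism of complexes, so the map it induces on cycles presents the
    homology of words as that of the injective nerve. *)
Lemma inj_nerve_converges : converges_to (spectral_sequence C) (Hn W).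
Proof.
apply: (@bounded_converges _ C _
  (fun k => submod_map_class (im (bnd W k.+1)) (@word_chain_ker k))) => k.
- move=> y; have [[w dw] ->] := subquo_classP y; have [c cw] := word_chain_onto w.
  have dc : c \in ker (bnd C k).
    by apply/kerP/word_chain_eq0; rewrite word_chain_bnd cw; apply/kerP.
  by exists (SubmodType dc); congr (subquo_class _ _ _); apply: val_inj.
- move=> x; split=> [/subquo_class0P/imP[w wx]|/imP[b bx]].
    have [b bw] := word_chain_onto w; apply/imP; exists b.
    apply/eqP; rewrite -subr_eq0; apply/eqP/word_chain_eq0.
    by rewrite linearB (word_chain_bnd b) bw wx subrr.
  apply/subquo_class0P/imP; exists (word_chain k.+1 b).
  by rewrite -(word_chain_bnd b) /= bx.
(* -1 lies below every chain degree. *)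
- by exists (- 1) => x; apply: inj_nerve_filt_low.
exact: inj_nerve_filt_top.
Qed.

End Abutment.
End Pages.

(** The mere existence of a morphism would be empty, as zero is one; the last clause fixes [f] on
    every page by its values on classes of cycles. *)
Theorem theorem5p15 (R : comPzRingType) (V : finType) (E : rel V) :
  let IE := spectral_sequence (inj_nerve_chains E R) in
  let MP := spectral_sequence (nerve_chains E R) in
  [/\ forall (k : nat) (l : int), lmod_iso (page IE l 1 k) (EMH E R k l),
      forall k : nat,
        lmod_iso (page IE k%:Z 2 k) (Hn (regular_path_complex E R) k),
      converges_to IE (Hn (chains R (inj_words E)))
    & exists f : ss_hom IE MP,
        forall (l : int) (r k : nat)
          (x : submod_type (cycles (inj_nerve_chains E R) l r%:Z k)),
        exists y : submod_type (cycles (nerve_chains E R) l r%:Z k),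
          submod_val y = normalized_incl R (inj_nerve E) (full_nerve E) k (submod_val x) /\
          f l r k (subquo_class _ (boundaries (inj_nerve_chains E R) l r%:Z k) x) =
          subquo_class _ (boundaries (nerve_chains E R) l r%:Z k) y].
Proof.
split=> [k l|k||].
- exact: first_page_iso.
- exact: second_page_iso.
- exact: inj_nerve_converges.
have SS' n x : inj_nerve E n x -> full_nerve E n x by [].
pose f_bnd := normalized_incl_bnd (R := R) SS'.
pose f_filt l n c :=
  @normalized_incl_filt _ R (inj_nerve E) (full_nerve E) _ (@nerve_filt_le V E) l n c.
(* Both filtrations are by the same length, so the inclusion of normalized chains preserves them and
   acts on every page. *)
exists (@filtered_ss_hom R (inj_nerve_chains E R) (nerve_chains E R) _
  f_bnd f_filt) => l r k x.
exists (submod_map (@map_cycles R (inj_nerve_chains E R) (nerve_chains E R) _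
  f_bnd f_filt l r k) x); split=> //.
exact: page_mapE.
Qed.
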